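(* Fix $\alpha\in(0,1]$ and let $R$ be as in the context. Then the induced system $(R,\mathcal{B},\bar\mu_R,\mathcal{F}_R)$ is the natural extension of Nakada's $\alpha$-continued fraction system $([\alpha-1,\alpha),\mathcal{B},\rho_\alpha,G_\alpha)$.
   Context: $\mathcal{B}$ denotes the Borel $\sigma$-algebra. Let $\Omega=[0,1]^2$ and $\mathcal{F}:\Omega\to\Omega$ be Ito's natural extension of the Farey tent map: $\mathcal{F}(x,y)=(x/(1-x),y/(1+y))$ if $x\le1/2$ and $((1-x)/x,1/(1+y))$ if $x>1/2$; it is a.e. invertible and preserves the infinite $\sigma$-finite measure $\bar\mu$ with density $1/(x+y-xy)^2$. For measurable $R$ with $0<\bar\mu(R)<\infty$, $N_R(z)=\inf\{n\ge1:\mathcal{F}^n(z)\in R\}$, $\mathcal{F}_R(z)=\mathcal{F}^{N_R(z)}(z)$ restricted to $R$, and $\bar\mu_R=\bar\mu|_R/\bar\mu(R)$. Let $H_1=[0,1]\times(1/2,1]$, $V_a=(1/(a+1),1/a]\times[0,1]$, $a(x)=\lfloor1/x\rfloor$, and $\mathcal{F}_{H_1}(z)=\mathcal{F}^{a(x)}(z)$ for $z=(x,y)\in H_1$ (induced map on $H_1$, a.e. invertible). Define $k(z)=\inf\{j>0:\mathcal{F}_{H_1}^{-j}(z)\in[0,\alpha)\times[1/2,1]\}$ for $z\in H_1$, $A=\{z\in H_1:k(z)\text{ odd}\}$, $A_a=A\cap V_a\cap([\alpha,1]\times[1/2,1])$ for integers $a>1$, and $R=A\cup\bigcup_{a>1}\bigcup_{\lambda=1}^{a-1}\mathcal{F}^\lambda(A_a)$.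 Nakada's $\alpha$-continued fraction map is $G_\alpha:[\alpha-1,\alpha)\to[\alpha-1,\alpha)$, $G_\alpha(0)=0$, $G_\alpha(x)=\frac1{|x|}-\left\lfloor\frac1{|x|}+1-\alpha\right\rfloor$ for $x\ne0$, and $\rho_\alpha$ is its unique absolutely continuous invariant probability measure. *)

(* Defs.v *)
From HB Require Import structures.
From mathcomp Require Import all_boot all_order all_algebra.
From mathcomp Require Import all_classical all_reals all_analysis measurable_realfun.
Set Implicit Arguments.
Unset Strict Implicit.
Unset Printing Implicit Defensive.
Import Order.TTheory GRing.Theory Num.Theory.
Import numFieldNormedType.Exports.
Local Open Scope classical_set_scope.
Local Open Scope ring_scope.

(* A dynamical system on a measurable subset [X] of a measurable type [T] is
   represented by a probability on [T] giving mass 1 to [X], and a map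
   [f : T -> T] whose values outside [X] are irrelevant. *)
Section Systems.
Context d (T : measurableType d) (K : realType).

Definition mp_system (X : set T) (mu : probability T K) (f : T -> T) : Prop :=
  [/\ measurable X /\ mu X = 1%E,
      set_fun X X f,
      measurable_fun X f &
      forall B, measurable B -> mu (X `&` f @^-1` B) = mu B].

(* [f] restricts to a bimeasurable bijection of the full-measure set [X0]. *)
Definition invertible_core (X : set T) (mu : probability T K) (f : T -> T)
    (X0 : set T) : Prop :=
  [/\ measurable X0 /\ mu X0 = 1%E,
      X0 `<=` X,
      set_bij X0 X0 f,
      measurable_fun X0 f &
      forall B, measurable B -> B `<=` X0 -> measurable (f @` B)].

End Systems.

(* [(Y, nu, S)] is an a.e. invertible extension of [(X, mu, f)], through a
   factor map [p] defined on a full-measure set [Y0], and it is minimal: the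
   sigma-algebra generated by the sets [S^n (p^-1 B)], [n >= 0], [B]
   measurable, is the whole sigma-algebra modulo [nu]-null sets. *)
Definition natural_extension d1 d2 (TY : measurableType d1)
    (TX : measurableType d2) (K : realType)
    (Y : set TY) (nu : probability TY K) (S : TY -> TY)
    (X : set TX) (mu : probability TX K) (f : TX -> TX) : Prop :=
  [/\ mp_system X mu f,
      mp_system Y nu S &
      exists (Y0 : set TY) (p : TY -> TX),
        [/\ invertible_core Y nu S Y0,
            set_fun Y0 X p /\ measurable_fun Y0 p,
            forall z, Y0 z -> p (S z) = f (p z),
            forall B, measurable B -> nu (Y0 `&` p @^-1` B) = mu B &
            forall C, measurable C ->
              exists2 D,
                <<s Y0, [set E | exists (n : nat) (B : set TX), measurable B /\
                           E = iter n S @` (Y0 `&` p @^-1` B)] >> D &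
                nu (C `+` D) = 0%E]].

(* Infimum of a set of naturals; [None] stands for inf set0 = oo. *)
Definition inf_nat (P : set nat) : option nat :=
  match pselect (exists n, `[< P n >]) with
  | left e => Some (ex_minn e)
  | right _ => None
  end.

Section Induced.
Context (T : Type) (f : T -> T) (A : set T).

Definition first_return (z : T) : option nat :=
  inf_nat [set n | (1 <= n)%N /\ A (iter n f z)].

Definition induced_map (z : T) : T :=
  if first_return z is Some n then iter n f z else z.

End Induced.

Section Farey.
Context {K : realType}.
(* [measurableTypeR K] is [K] with its Borel sigma-algebra, as used by
   [lebesgue_measure]. *)
Local Notation line := (measurableTypeR K).
Local Notation plane := (line * line)%type.
Implicit Types (x : line) (alpha : K) (z : plane).

Definition Omega : set plane := `[0, 1] `*` `[0, 1].

Definition Farey_ext z : plane :=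
  if z.1 <= 2^-1 then (z.1 / (1 - z.1), z.2 / (1 + z.2))
  else ((1 - z.1) / z.1, 1 / (1 + z.2)).

Definition mubar_density z : K := 1 / (z.1 + z.2 - z.1 * z.2) ^+ 2.

Definition mubar (B : set plane) : \bar K :=
  (\int[lebesgue_measure \x lebesgue_measure]_(z in B `&` Omega)
     (mubar_density z)%:E)%E.

Let denom_measurable :
  measurable_fun setT (fun z : plane => z.1 + z.2 - z.1 * z.2).
Proof.
apply: measurable_funB; first by apply: measurable_funD.
by apply: measurable_funM.
Qed.

Lemma measurable_mubar_density : measurable_fun setT mubar_density.
Proof.
have minv : measurable_fun [set: K] (fun t : K => 1 / t ^+ 2).
  have -> : [set: K] = [set 0] `|` ~` [set 0] by rewrite setUv.
  apply/measurable_funU => //; first by apply: measurableC.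
  split; first exact: measurable_fun_set1.
  apply: open_continuous_measurable_fun.
    by rewrite openC; exact: closed_eq.
  move=> t; rewrite inE/= => /eqP t0.
  apply: (@continuousM _ _ (cst 1) (fun t : K => (t ^+ 2)^-1)).
    exact: cst_continuous.
  by apply: continuousV; [rewrite expf_neq0|exact: exprn_continuous].
exact: (measurableT_comp minv denom_measurable).
Qed.

Lemma measurable_Omega : measurable Omega.
Proof. by apply: measurableX. Qed.

Let mubar_density_ge0 z : 0 <= mubar_density z.
Proof. by rewrite divr_ge0// sqr_ge0. Qed.

Let mubar0 : mubar set0 = 0%E.
Proof. by rewrite /mubar set0I integral_set0. Qed.

Let mubar_ge0 B : (0 <= mubar B)%E.
Proof. by apply: integral_ge0 => z _; rewrite lee_fin. Qed.

Let mubar_semi_sigma_additive : semi_sigma_additive mubar.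
Proof.
move=> F mF tF mUF; rewrite /mubar; apply: cvg_toP.
  apply: ereal_nondecreasing_is_cvgn => m n mn.
  by apply: lee_sum_nneg_natr => // i _ _; exact: mubar_ge0.
rewrite setI_bigcupl ge0_integral_bigcup//=.
- by move=> k; apply: measurableI => //; exact: measurable_Omega.
- apply/measurable_funTS/measurableT_comp => //.
  exact: measurable_mubar_density.
- by move=> z _; rewrite lee_fin.
- apply/trivIsetP => i j _ _ ij; move/trivIsetP : tF => /(_ i j I I ij).
  by rewrite setIACA => ->; rewrite set0I.
Qed.

HB.instance Definition _ := isMeasure.Build _ _ _ mubar
  mubar0 mubar_ge0 mubar_semi_sigma_additive.

(* The normalized restriction mubar(. `&` D) / mubar(D); the Dirac mass is the
   dummy value of [mnormalize] used when mubar(D) is 0 or +oo. *)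
Definition mubar_restr (D : set plane) (mD : measurable D) :
    probability plane K :=
  mnormalize (mrestr mubar mD) \d_((0, 0) : plane).

Definition H1 : set plane := `[0, 1] `*` `]2^-1, 1].

Definition cylV (a : nat) : set plane :=
  `](a.+1%:R)^-1, (a%:R)^-1] `*` `[0, 1].

(* [0^-1 = 0], so [digit 0 = 0] and [F_H1] is the identity on the null set
   [x = 0]. *)
Definition digit x : nat := Num.truncn x^-1.

Definition F_H1 z : plane := iter (digit z.1) Farey_ext z.

(* [F_H1] is invertible only almost everywhere: F_H1^(-j)(z) \in C is read as
   "some point of [C `&` H1] is sent to [z] by [F_H1^j]". *)
Definition past_hit alpha z : option nat :=
  inf_nat [set j | (0 < j)%N /\
    (iter j F_H1 @` (H1 `&` (`[0, alpha[ `*` `[2^-1, 1]))) z].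

Definition setA alpha : set plane :=
  [set z | H1 z /\ exists2 j, past_hit alpha z = Some j & odd j].

Definition setA_ alpha (a : nat) : set plane :=
  setA alpha `&` cylV a `&` (`[alpha, 1] `*` `[2^-1, 1]).

Definition domR alpha : set plane :=
  setA alpha `|`
  \bigcup_(a in [set a | (1 < a)%N])
    \bigcup_(l in [set l | (1 <= l <= a - 1)%N])
      (iter l Farey_ext @` setA_ alpha a).

Definition Farey_R alpha : plane -> plane := induced_map Farey_ext (domR alpha).

Definition I_ alpha : set line := `[alpha - 1, alpha[.

Definition Nakada alpha x : line :=
  if x == 0 then 0
  else 1 / `|x| - (Num.floor (1 / `|x| + 1 - alpha))%:~R.

Definition acip alpha (rho : probability line K) : Prop :=
  mp_system (I_ alpha) rho (Nakada alpha) /\ rho `<< lebesgue_measure.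

Definition unique_acip alpha (rho : probability line K) : Prop :=
  acip alpha rho /\
  forall rho', acip alpha rho' -> forall B, measurable B -> rho' B = rho B.

End Farey.

(* Main.v *)
Require Import Defs.
From mathcomp Require Import all_boot all_order all_algebra.
From mathcomp Require Import all_classical all_reals all_analysis measurable_realfun.
From mathcomp Require Import ring lra zify.
Import Order.TTheory GRing.Theory Num.Theory.
Import numFieldNormedType.Exports.
Local Open Scope classical_set_scope.
Local Open Scope ring_scope.

(** Write D(x, y) = x + y - xy. The mubar-measure of a rectangle is the logarithm
    of a cross-ratio of the values of D at its four corners, and on each branch of
    the Farey map F one has D(F(x, y)) = D(x, y) u(x) v(y), so F preserves mubar.

    For z = (x, y) in R, the first return time of F to R depends on x only: it is
    a(x) if x < alpha, it is 1 if alpha <= x <= 1/2, and it is 1 + a(F(x))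
    otherwise; this follows from k(F_H1(z)) = k(z) + 1 when x >= alpha, and
    k(F_H1(z)) = 1 otherwise. Comparing with G_alpha, the map sending z to x if
    x < alpha and to x - 1 otherwise intertwines F_R and G_alpha. It pushes mubar_R
    forward to an absolutely continuous invariant probability, which is rho_alpha
    by uniqueness.

    F_R is injective and preserves a finite measure, so it is onto up to null sets.
    Finally y is recovered from the past of the factor: n steps of F_R determine y
    up to 1/(n + 1) from the first coordinate of the n-th preimage, because the
    composition of n Farey branches in y has an image of length at most 1/(n + 1). *)

Set Implicit Arguments.
Unset Strict Implicit.
Unset Printing Implicit Defensive.

(** * Measurability of iterates and images *)

Section MeasurableIterates.
Context d (T : measurableType d).
Implicit Types (f : T -> T) (r : T -> nat).

Lemma measurable_iter f n :
  measurable_fun setT f -> measurable_fun setT (iter n f).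
Proof.
move=> mf; elim: n => [|n IH]; first exact: measurable_id.
exact: (measurableT_comp mf IH).
Qed.

Lemma iter_time_preimage f r (B : set T) :
  (fun z => iter (r z) f z) @^-1` B =
  \bigcup_n (r @^-1` [set n] `&` iter n f @^-1` B).
Proof.
apply/seteqP; split => [z Bz|z [n _ [<-]]//].
by exists (r z).
Qed.

Lemma measurable_iter_time f r : measurable_fun setT f ->
  (forall n, measurable (r @^-1` [set n])) ->
  measurable_fun setT (fun z => iter (r z) f z).
Proof.
move=> mf mr _ B mB; rewrite setTI iter_time_preimage.
apply: bigcupT_measurable => n; apply: measurableI => //.
by rewrite -[X in measurable X]setTI; exact: measurable_iter.
Qed.

(* Images of measurable sets are controlled through explicit inverse branches,
   so that no Lusin-Souslin theorem is needed. *)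
Definition stable_images (X : set T) f :=
  forall B, measurable B -> B `<=` X ->
    measurable (f @` B) /\ f @` B `<=` X.

Lemma stable_images_iter (X : set T) f n :
  stable_images X f -> stable_images X (iter n f).
Proof.
move=> fX; elim: n => [|n IH] B mB BX; first by rewrite image_id.
have -> : iter n.+1 f @` B = f @` (iter n f @` B) by rewrite -image_comp.
by have [? ?] := IH _ mB BX; exact: fX.
Qed.

Lemma iter_time_image f r (B : set T) :
  (fun z => iter (r z) f z) @` B =
  \bigcup_n (iter n f @` (B `&` r @^-1` [set n])).
Proof.
apply/seteqP; split => [_ [z Bz <-]|_ [n _ [z [Bz <-] <-]]]; last by exists z.
by exists (r z) => //; exists z.
Qed.

Lemma stable_images_iter_time (X : set T) f r : stable_images X f ->
  (forall n, measurable (r @^-1` [set n])) ->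
  stable_images X (fun z => iter (r z) f z).
Proof.
move=> fX mr B mB BX; rewrite iter_time_image.
have fXn n := @stable_images_iter X f n fX (B `&` r @^-1` [set n])
  (measurableI _ _ mB (mr n)) (fun z => fun h => BX z h.1).
split; first by apply: bigcupT_measurable => n; exact: (fXn n).1.
by apply: bigcup_sub => n _; exact: (fXn n).2.
Qed.

End MeasurableIterates.

(** * Measurability of inversion and of the digit function *)

Lemma measurable_invr {K : realType} : measurable_fun [set: K] (@GRing.inv K).
Proof.
have -> : [set: K] = [set 0] `|` ~` [set 0] by rewrite setUv.
apply/measurable_funU => //; first by apply: measurableC.
split; first exact: measurable_fun_set1.
apply: open_continuous_measurable_fun.
  by rewrite openC; exact: closed_eq.
by move=> t; rewrite inE/= => /eqP t0; exact: inv_continuous.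
Qed.

Lemma measurable_fun_divr {K : realType} d (T : measurableType d)
    (f g : T -> K) : measurable_fun setT f -> measurable_fun setT g ->
  measurable_fun setT (fun x => f x / g x).
Proof.
move=> mf mg; apply: measurable_funM => //.
exact: (measurableT_comp measurable_invr mg).
Qed.

Lemma measurable_digit_preimage {K : realType} n :
  measurable ((@digit K) @^-1` [set n]).
Proof.
(* The sets [digit x <= m] are preimages of rays under inversion; level sets are then differences of
   two of them. *)
have mle m : measurable [set x : measurableTypeR K | (digit x <= m)%N].
  rewrite (_ : mkset _ = (@GRing.inv K) @^-1` `]-oo, m.+1%:R[%classic).
    by rewrite -[X in measurable X]setTI; exact: measurable_invr.
  by apply/seteqP; split => x /=; rewrite in_itv/= /digit truncn_le_nat.
case: n => [|n].
  rewrite (_ : _ @^-1` _ = [set x | (digit x <= 0)%N])//.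
  by apply/seteqP; split => x /=; rewrite leqn0 => /eqP.
rewrite (_ : _ @^-1` _ = [set x | (digit x <= n.+1)%N] `\`
                         [set x | (digit x <= n)%N]); first exact: measurableD.
apply/seteqP; split => x /=; first by move=> ->; rewrite ltnn.
by case=> h1 h2; apply/eqP; rewrite eqn_leq h1 ltnNge; exact/negP.
Qed.

Lemma measurable_set_ler {K : realType} d (T : measurableType d)
    (f g : T -> K) : measurable_fun setT f -> measurable_fun setT g ->
  measurable [set z | f z <= g z].
Proof.
move=> mf mg; rewrite -[X in measurable X]setTI.
exact: (measurable_fun_ler mf mg measurableT (Y := [set true])).
Qed.

(** * The Farey map and its inverse branches *)

Section FareyMeasurable.
Context {K : realType}.
Local Notation line := (measurableTypeR K).
Local Notation plane := (line * line)%type.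
Local Notation F := (@Farey_ext K).

Lemma measurable_Farey_ext : measurable_fun setT F.
Proof.
apply: measurable_fun_ifT.
- by apply: measurable_fun_ler => //; exact: measurable_fst.
- apply: measurable_fun_pair; apply: measurable_fun_divr => //.
  + by apply: measurable_funB.
  + by apply: measurable_funD.
- apply: measurable_fun_pair; apply: measurable_fun_divr => //.
  + by apply: measurable_funB.
  + by apply: measurable_funD.
Qed.

(** Inverses of the branches for x at most 1/2 and x above 1/2. The images of these branches in
    [Omega] lie in y <= 1/2 and y >= 1/2 respectively. *)
Definition Farey_inv1 (w : plane) : plane := (w.1 / (1 + w.1), w.2 / (1 - w.2)).
Definition Farey_inv2 (w : plane) : plane := (1 / (1 + w.1), 1 / w.2 - 1).

Lemma measurable_Farey_inv1 : measurable_fun setT Farey_inv1.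
Proof.
apply: measurable_fun_pair; apply: measurable_fun_divr => //.
- by apply: measurable_funD.
- by apply: measurable_funB.
Qed.

Lemma measurable_Farey_inv2 : measurable_fun setT Farey_inv2.
Proof.
apply: measurable_fun_pair; last apply: measurable_funB => //.
  by apply: measurable_fun_divr => //; apply: measurable_funD.
exact: measurable_fun_divr.
Qed.

Lemma OmegaP (z : plane) :
  Omega z <-> [/\ 0 <= z.1, z.1 <= 1, 0 <= z.2 & z.2 <= 1].
Proof.
rewrite /Omega /=; rewrite !in_itv/=; split.
  by move=> [/andP[-> ->] /andP[-> ->]].
by move=> [-> -> -> ->].
Qed.

Lemma Farey_ext_Omega (z : plane) : Omega z -> Omega (F z).
Proof.
move=> /OmegaP[x0 x1 y0 y1]; apply/OmegaP; rewrite /Farey_ext; case: ifPn => xh /=.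
  have xp : 0 < 1 - z.1 by lra.
  have yp : 0 < 1 + z.2 by lra.
  by rewrite !ler_pdivrMr// !ler_pdivlMr// !mul0r !mul1r; split; lra.
rewrite -ltNge in xh.
have xp : 0 < z.1 by lra.
have yp : 0 < 1 + z.2 by lra.
by rewrite !ler_pdivrMr// !ler_pdivlMr// !mul0r !mul1r; split; lra.
Qed.

(** The image splits along the two branches, and each piece is the preimage of a measurable set
    under an explicit, measurable inverse branch. *)
Lemma Farey_ext_stable_images : stable_images Omega F.
Proof.
move=> B mB BO; split; last by move=> _ [z /BO Oz <-]; exact: Farey_ext_Omega.
have mleft : measurable [set z : plane | z.1 <= 2^-1].
  exact: measurable_set_ler.
have -> : F @` B =
    Omega `&` [set w | w.2 <= 2^-1] `&`
      Farey_inv1 @^-1` (B `&` [set z : plane | z.1 <= 2^-1]) `|`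
    Omega `&` [set w | 2^-1 <= w.2] `&`
      Farey_inv2 @^-1` (B `&` ~` [set z : plane | z.1 <= 2^-1]).
  apply/seteqP; split=> [w [z Bz <-]|[u v]].
    have FO := Farey_ext_Omega (BO _ Bz).
    have /OmegaP[] := BO _ Bz.
    case: z Bz FO => x y Bz FO /= x0 x1 y0 y1.
    have [xh|xh] := leP x 2^-1.
      have xp : 1 - x != 0 by lra.
      have yp : 0 < 1 + y by lra.
      have yp' : 1 + y != 0 by lra.
      left; split; first split => //.
        by rewrite /= /Farey_ext/= xh/= ler_pdivrMr//; lra.
      rewrite /= /Farey_inv1 /Farey_ext/= xh/=.
      suff [-> ->] : x / (1 - x) / (1 + x / (1 - x)) = x /\
        y / (1 + y) / (1 - y / (1 + y)) = y by [].
      by split; field; rewrite ?xp ?yp' ?andTb ?andbT; lra.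
    have xp : x != 0 by lra.
    have yp : 0 < 1 + y by lra.
    have yp' : 1 + y != 0 by lra.
    right; split; first split => //.
      by rewrite /= /Farey_ext/= (lt_geF xh)/= ler_pdivlMr//; lra.
    rewrite /= /Farey_inv2 /Farey_ext/= (lt_geF xh)/=.
    suff [-> ->] : 1 / (1 + (1 - x) / x) = x /\ 1 / (1 / (1 + y)) - 1 = y.
      by split => //=; rewrite (lt_geF xh).
    by split; field; rewrite ?xp ?yp' ?andTb ?andbT; lra.
  move=> [[[Ow /= vh] [Bz /= zh]]|[[Ow /= vh] [Bz /= zh]]].
    exists (Farey_inv1 (u, v)) => //; move/OmegaP : Ow => /=[u0 u1 v0 v1].
    rewrite /Farey_ext /Farey_inv1/= in zh *; rewrite zh; congr pair; field; lra.
  exists (Farey_inv2 (u, v)) => //; move/OmegaP : Ow => /=[u0 u1 v0 v1].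
  move/negP : zh.
  rewrite /Farey_ext /Farey_inv2/= => /negbTE ->; congr pair; field; lra.
apply: measurableU; apply: measurableI.
- apply: measurableI; first exact: measurable_Omega.
  exact: measurable_set_ler.
- rewrite -[X in measurable X]setTI; apply: measurable_Farey_inv1 => //.
  exact: measurableI.
- apply: measurableI; first exact: measurable_Omega.
  exact: measurable_set_ler.
- rewrite -[X in measurable X]setTI; apply: measurable_Farey_inv2 => //.
  by apply: measurableI => //; exact: measurableC.
Qed.

End FareyMeasurable.

(** * Rational numbers as a countable exceptional set *)

Section RationalPoints.
Context {K : realType}.
Implicit Types x y : K.

Lemma rationalB x y : rational x -> rational y -> rational (x - y).
Proof. by move=> [p _ <-] [q _ <-]; exists (p - q) => //; rewrite rmorphB. Qed.

Lemma rational_div x y : rational x -> rational y -> rational (x / y).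
Proof. by move=> [p _ <-] [q _ <-]; exists (p / q) => //; rewrite fmorph_div. Qed.

Lemma rational1 : rational (1 : K).
Proof. by exists 1 => //; rewrite rmorph1. Qed.

Lemma rationalD x y : rational x -> rational y -> rational (x + y).
Proof. by move=> [p _ <-] [q _ <-]; exists (p + q) => //; rewrite rmorphD. Qed.

Lemma countable_rational : countable (@rational K).
Proof. exact: (sub_countable (card_image_le _ _) (countableP _)). Qed.

Lemma measurable_rational : measurable (@rational K : set (measurableTypeR K)).
Proof. by apply: countable_measurable => //; exact: countable_rational. Qed.

Lemma irrational_neq0 x : irrational x -> x != 0.
Proof.
by apply: contra_notN => /eqP ->; rewrite -(subrr 1); apply: rationalB; exact: rational1.
Qed.

Lemma irrational_neq1 x : irrational x -> x != 1.
Proof. by apply: contra_notN => /eqP ->; exact: rational1. Qed.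

End RationalPoints.

Lemma inf_nat_Some (P : set nat) n :
  inf_nat P = Some n <-> P n /\ forall m, (m < n)%N -> ~ P m.
Proof.
rewrite /inf_nat; case: pselect => [e|ne]; last first.
  by split=> // -[Pn _]; case: ne; exists n; exact/asboolP.
case: ex_minnP => m Pm mP; split=> [[<-]|[Pn nP]].
  split=> [|k km Pk]; first exact/asboolP.
  by have /mP := asboolT Pk; rewrite leqNgt km.
congr Some; apply/eqP; rewrite eqn_leq (mP _ (asboolT Pn)) leqNgt /=.
by apply/negP => mn; apply: (nP m mn); exact/asboolP.
Qed.

(** * Measurability of the domain, and the irrational points *)

Section Domain.
Context {K : realType}.
Local Notation line := (measurableTypeR K).
Local Notation plane := (line * line)%type.
Local Notation F := (@Farey_ext K).
Implicit Types (z w : plane) (alpha : K).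

Lemma measurable_H1 : measurable (@H1 K).
Proof. by apply: measurableX. Qed.

Lemma H1_Omega : @H1 K `<=` Omega.
Proof.
move=> z [/= z1]; rewrite /= !in_itv/= => /andP[y0 y1].
by split => //=; rewrite in_itv/= y1 andbT; lra.
Qed.

Lemma measurable_digit_fst n :
  measurable ((fun z : plane => digit z.1) @^-1` [set n]).
Proof.
rewrite -[X in measurable X]setTI.
exact: (@measurable_fst _ _ line line measurableT _
  (measurable_digit_preimage n)).
Qed.

Lemma F_H1_stable_images : stable_images Omega (@F_H1 K).
Proof.
exact: (stable_images_iter_time Farey_ext_stable_images measurable_digit_fst).
Qed.

Definition hit_set alpha (j : nat) : set plane :=
  iter j F_H1 @` (H1 `&` (`[0, alpha[ `*` `[2^-1, 1])).

Lemma measurable_hit_set alpha j : measurable (hit_set alpha j).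
Proof.
apply: (stable_images_iter j F_H1_stable_images _ _).1.
  by apply: measurableI; [exact: measurable_H1|exact: measurableX].
by move=> z [/H1_Omega].
Qed.

(** Spelling out the infimum in [past_hit] as a first hit writes the set with countably many
    operations on the measurable sets [hit_set alpha j]. *)
Lemma setAE alpha : setA alpha = H1 `&` \bigcup_(j in [set j | odd j])
  (hit_set alpha j `\` \bigcup_(i in [set i | (0 < i < j)%N]) hit_set alpha i).
Proof.
apply/seteqP; split => [z [Hz [j /inf_nat_Some[[j0 zj] jP] oj]]|].
  split => //; exists j => //; split => // -[i /= /andP[i0 ij] zi].
  exact: jP ij _.
move=> z [Hz [j oj [zj nz]]]; split => //; exists j => //.
apply/inf_nat_Some; split; first by split => //; exact: odd_gt0.
move=> i ij [i0 zi]; apply: nz; exists i => //=.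
by rewrite i0.
Qed.

Lemma measurable_setA alpha : measurable (setA alpha).
Proof.
rewrite setAE; apply: measurableI; first exact: measurable_H1.
apply: bigcup_measurable => j _; apply: measurableD.
  exact: measurable_hit_set.
by apply: bigcup_measurable => i _; exact: measurable_hit_set.
Qed.

Lemma measurable_setA_ alpha a : measurable (setA_ alpha a).
Proof.
apply: measurableI; last exact: measurableX.
by apply: measurableI; [exact: measurable_setA|exact: measurableX].
Qed.

Lemma setA__Omega alpha a : setA_ alpha a `<=` Omega.
Proof. by move=> z [[[/H1_Omega]]]. Qed.

Lemma measurable_domR alpha : measurable (domR alpha).
Proof.
apply: measurableU; first exact: measurable_setA.
apply: bigcup_measurable => a _; apply: bigcup_measurable => l _.
apply: (stable_images_iter l Farey_ext_stable_images _ _).1.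
  exact: measurable_setA_.
exact: setA__Omega.
Qed.

(* The two branches of [Farey_ext] overlap only in the image of [y = 1], so
   [Farey_ext] is injective on irrational points, a set it maps into itself. *)
Definition good : set plane :=
  [set z | Omega z /\ irrational z.1 /\ irrational z.2].

Lemma measurable_good : measurable good.
Proof.
rewrite (_ : good = Omega `&` (irrational `*` irrational))//.
apply: measurableI; first exact: measurable_Omega.
by apply: measurableX; apply: measurableC; exact: measurable_rational.
Qed.

Lemma goodP z : good z <-> [/\ 0 < z.1 < 1, 0 < z.2 < 1,
  irrational z.1 & irrational z.2].
Proof.
split=> [[/OmegaP[x0 x1 y0 y1] [ix iy]]|[/andP[x0 x1] /andP[y0 y1] ix iy]].
  by split=> //; rewrite !lt_neqAle ?x0 ?x1 ?y0 ?y1 ?andbT;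
    rewrite ?(eq_sym 0) ?irrational_neq0 ?irrational_neq1.
by split=> //; apply/OmegaP; rewrite !ltW.
Qed.

Lemma rational_Farey_ext z :
  (rational z.1 -> rational (F z).1) /\ (rational z.2 -> rational (F z).2).
Proof.
have r1 := @rational1 K.
rewrite /Farey_ext; case: ifPn => _ /=; split => r; apply: rational_div => //;
  by [apply: rationalB|apply: rationalD].
Qed.

Lemma good_Farey_ext_inv z : Omega z -> good (F z) -> good z.
Proof.
move=> Oz [_ [ix iy]]; have [r1 r2] := rational_Farey_ext z.
by split => //; split => [/r1|/r2].
Qed.

(** The second coordinate of an image point tells which branch produced it; on images of [good]
    points there is no tie at 1/2. *)
Definition Farey_inv (w : plane) : plane :=
  if w.2 <= 2^-1 then Farey_inv1 w else Farey_inv2 w.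

Lemma Farey_extK z : good z -> Farey_inv (F z) = z.
Proof.
move=> /goodP[/andP[x0 x1] /andP[y0 y1] ix iy].
have yp : 0 < 1 + z.2 by lra.
rewrite /Farey_inv /Farey_ext; case: (leP z.1 2^-1) => h /=.
  rewrite ifT; last by rewrite ler_pdivrMr//; lra.
  rewrite [RHS]surjective_pairing /Farey_inv1/=; congr pair; field; lra.
rewrite ifF; last by apply/negbTE; rewrite -ltNge ltr_pdivlMr//; lra.
rewrite [RHS]surjective_pairing /Farey_inv2/=; congr pair; field; lra.
Qed.

Lemma Farey_ext_inj z w : good z -> good w -> F z = F w -> z = w.
Proof. by move=> gz gw Fzw; rewrite -(Farey_extK gz) Fzw Farey_extK. Qed.

(** The inverse branches have rational coefficients and act on each coordinate separately, so a
    rational coordinate of [F z] would make the same coordinate of [z] rational. *)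
Lemma good_Farey_ext z : good z -> good (F z).
Proof.
move=> gz; have [Oz [ix iy]] := gz; split; first exact: Farey_ext_Omega.
have r1 := @rational1 K; have := Farey_extK gz; rewrite /Farey_inv.
have r w : (rational w.1 -> rational (Farey_inv1 w).1 /\ rational (Farey_inv2 w).1)
   /\ (rational w.2 -> rational (Farey_inv1 w).2 /\ rational (Farey_inv2 w).2).
  rewrite /Farey_inv1 /Farey_inv2 /=; split=> r; split;
    by repeat (apply: rational_div => // || apply: rationalB => // ||
               apply: rationalD => //).
by case: ifPn => _ e; split => rF; [apply: ix|apply: iy|apply: ix|apply: iy];
  rewrite -e; have [a b] := r (F z);
  [case: (a rF)|case: (b rF)|case: (a rF)|case: (b rF)].
Qed.

Lemma good_iter n z : good z -> good (iter n F z).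
Proof. by move=> gz; elim: n => //= n; exact: good_Farey_ext. Qed.

Lemma Omega_iter n z : Omega z -> Omega (iter n F z).
Proof. by move=> gz; elim: n => //= n; exact: Farey_ext_Omega. Qed.

Lemma good_iter_inv n z : Omega z -> good (iter n F z) -> good z.
Proof.
move=> Oz; elim: n => //= n IH /good_Farey_ext_inv h.
by apply: IH; apply: h; exact: Omega_iter.
Qed.

Lemma iter_inj n z w : good z -> good w -> iter n F z = iter n F w -> z = w.
Proof.
move=> gz gw; elim: n => //= n IH h; apply: IH.
by apply: Farey_ext_inj h; exact: good_iter.
Qed.

End Domain.

(** * The measure mubar of rectangles *)

Section Rectangles.
Context {K : realType}.
Local Notation line := (measurableTypeR K).
Local Notation plane := (line * line)%type.
Local Notation leb := (@lebesgue_measure K).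

(** The fundamental theorem of calculus for all types of endpoints at once. Derivability up to the
    closed endpoints supplies the one-sided limits. *)
Lemma integral_itv_is_derive (f F : K -> K) (a b : K) (s t : bool) : a < b ->
  measurable_fun setT (f : line -> line) ->
  (forall x, a <= x <= b -> derivable F x 1 /\ 'D_1 F x = f x) ->
  (forall x, a <= x <= b -> derivable f x 1) ->
  (\int[leb]_(x in [set` Interval (BSide s a) (BSide t b)]) (f x)%:E =
   (F b - F a)%:E)%E.
Proof.
move=> ab mf dF df.
have cF x : a <= x <= b -> {for x, continuous F}.
  move=> xab; apply/differentiable_continuous/derivable1_diffP.
  by have [] := dF x xab.
have mEf : measurable_fun (`]a, b[%classic : set line) (EFin \o f).
  by apply: measurable_funTS; exact/measurable_EFinP.
rewrite integral_itv_bndoo// -(integral_itv_bndoo true false)//.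
rewrite EFinB; apply: continuous_FTC2 => //.
- apply: derivable_within_continuous => x; rewrite in_itv/=; exact: df.
- split.
  + move=> x; rewrite in_itv/= => /andP[/ltW ax /ltW xb].
    by have [] := dF x; rewrite ?ax.
  + by apply: cvg_at_right_filter; apply: cF; rewrite lexx ltW.
  + by apply: cvg_at_left_filter; apply: cF; rewrite lexx ltW.
- move=> x; rewrite in_itv/= => /andP[/ltW ax /ltW xb]; rewrite derive1E.
  by have [] := dF x; rewrite ?ax.
Qed.

Lemma mubarX (A B : set line) : measurable A -> measurable B ->
  A `*` B `<=` Omega ->
  mubar (A `*` B) =
  (\int[leb]_(x in A) \int[leb]_(y in B) (mubar_density (x, y))%:E)%E.
Proof.
move=> mA mB ABO; rewrite /mubar (setIidl ABO).
have mf : measurable_fun setT (EFin \o @mubar_density K).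
  by apply/measurable_EFinP; exact: measurable_mubar_density.
rewrite integral_mkcond fubini_tonelli1//=; last 2 first.
- apply/(measurable_restrictT _ _).1 => //; first exact: measurableX.
  exact: measurable_funTS.
- by move=> z; apply: erestrict_ge0 => w _; rewrite lee_fin divr_ge0// sqr_ge0.
rewrite [RHS]integral_mkcond; apply: eq_integral => x _.
rewrite /fubini_F patchE; case: ifPn => xA.
  rewrite [RHS]integral_mkcond; apply: eq_integral => y _.
  by rewrite !patchE in_setX xA.
by apply: integral0_eq => y _; rewrite patchE in_setX (negbTE xA).
Qed.

Definition denom (x y : K) : K := x + y - x * y.

Lemma denomE x y : denom x y = y + (1 - y) * x.
Proof. rewrite /denom; ring. Qed.

Lemma measurable_denom y : measurable_fun setT (denom ^~ y : line -> line).
Proof.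
rewrite (_ : denom ^~ y = fun x => y + (1 - y) * x).
  by apply: measurable_funD; [exact: measurable_cst|exact: mulrl_measurable].
by apply/funext => x; rewrite denomE.
Qed.

Lemma denomC x y : denom x y = denom y x.
Proof. rewrite /denom; ring. Qed.

Lemma denom_gt0 x y : 0 < x -> x <= 1 -> 0 <= y -> y <= 1 -> 0 < denom x y.
Proof. by rewrite /denom => *; nra. Qed.

Instance is_derive_affine (p q x : K) :
  is_derive x 1 (fun t : K => p + q * t) q.
Proof.
have -> : (fun t : K => p + q * t) = cst p + q *: id by [].
apply: is_derive_eq; by rewrite add0r /GRing.scale/= mulr1.
Qed.

Lemma is_derive_denom_inv x y : denom x y != 0 -> is_derive y 1 (fun t => (denom x t)^-1)
   (- (denom x y) ^- 2 * (1 - x)).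
Proof.
move=> D0; apply: is_deriveV => //.
rewrite (_ : denom x = fun t => x + (1 - x) * t).
  exact: is_derive_affine.
by apply/funext => t; rewrite denomC denomE.
Qed.

Lemma integral_denom_y x c d (s t : bool) :
  0 < x -> x <= 1 -> 0 <= c -> c < d -> d <= 1 ->
  (\int[leb]_(y in [set` Interval (BSide s c) (BSide t d)])
      (mubar_density ((x, y) : plane))%:E =
   ((d - c) / (denom x c * denom x d))%:E)%E.
Proof.
move=> x0 x1 c0 cd d1.
have D0 y : c <= y <= d -> denom x y != 0.
  by move=> /andP[cy yd]; rewrite gt_eqF// denom_gt0//; lra.
(* An antiderivative of 1/D(x, y)^2 in y is y/(x D(x, y)), because D(x, y) - y(1 - x) = x. *)
rewrite (@integral_itv_is_derive _ (fun y => y * x^-1 * (denom x y)^-1))//.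
- congr EFin; have := D0 c; have := D0 d; rewrite /denom !lexx/= andbT ltW//.
  move=> /(_ isT) Dd /(_ isT) Dc; field.
  by rewrite Dc Dd gt_eqF.
- exact: (measurableT_comp (@measurable_mubar_density K) (pair1_measurable _)).
- move=> y /D0 Dy; have := is_derive_denom_inv Dy => dD.
  have dy : is_derive y 1 (fun y => y * x^-1) x^-1.
    have -> : (fun y => y * x^-1) = (fun t => 0 + x^-1 * t).
      by apply/funext => r; rewrite add0r mulrC.
    exact: is_derive_affine.
  suff [h1 h2] : is_derive y 1 (fun y => y * x^-1 * (denom x y)^-1)
      (mubar_density ((x, y) : plane)) by [].
  apply: is_derive_eq; rewrite /mubar_density /=.
  rewrite -/(denom x y) /GRing.scale/=; rewrite /denom in Dy *; field.
  by rewrite Dy gt_eqF.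
- move=> y /D0 Dy; have [dD _] := is_derive_denom_inv Dy.
  have -> : (fun y => mubar_density ((x, y) : plane)) =
      (fun t => (denom x t)^-1) * (fun t => (denom x t)^-1).
    by apply/funext => u; rewrite /mubar_density /= div1r expr2 invfM.
  exact: derivableM.
Qed.

(* The logarithm of a cross-ratio of the four corner values of [denom]. Since
   [denom (F z)] is [denom z] times a function of [z.1] times a function of
   [z.2] on each branch, cross-ratios are preserved by [F]. *)
Lemma mubar_rect a b c d (s t u v : bool) :
  0 < a -> a < b -> b <= 1 -> 0 <= c -> c < d -> d <= 1 ->
  mubar ([set` Interval (BSide s a) (BSide t b)] `*`
         [set` Interval (BSide u c) (BSide v d)] : set plane) =
  (ln (denom b c) - ln (denom b d) - (ln (denom a c) - ln (denom a d)))%:E.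
Proof.
move=> a0 ab b1 c0 cd d1; rewrite mubarX//; last first.
  move=> z [/= z1 z2]; apply/OmegaP; move: z1 z2; rewrite !in_itv/= => z1 z2.
  have [h1 h2] : a <= z.1 /\ z.1 <= b.
    by split; case: s t z1 => -[] /andP[] //; try (by move=> /ltW); by move=> _ /ltW.
  have [h3 h4] : c <= z.2 /\ z.2 <= d.
    by split; case: u v z2 => -[] /andP[] //; try (by move=> /ltW); by move=> _ /ltW.
  by split; lra.
have Dgt0 x y : a <= x <= b -> c <= y <= d -> 0 < denom x y.
  by move=> /andP[ax xb] /andP[cy yd]; apply: denom_gt0; lra.
under eq_integral => x.
  rewrite inE/= in_itv/= => xab.
  have [h1 h2] : a <= x /\ x <= b.
    by split; case: s t xab => -[] /andP[] //; try (by move=> /ltW); by move=> _ /ltW.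
  rewrite integral_denom_y//; [|lra|lra].
  over.
(* The integrand (d - c)/(D(x, c) D(x, d)) has the partial fractions (1 - c)/D(x, c) - (1 - d)/D(x,
   d), which are logarithmic derivatives. *)
rewrite (@integral_itv_is_derive _ (fun x => ln (denom x c) - ln (denom x d)))//.
- apply: measurable_fun_divr => //.
  by apply: measurable_funM; exact: measurable_denom.
- move=> x xab; have Dc : 0 < denom x c by apply: Dgt0 => //; rewrite ?lexx ltW.
  have Dd : 0 < denom x d by apply: Dgt0 => //; rewrite ?lexx ltW.
  have dln y : 0 < denom x y ->
      is_derive x 1 (fun x => ln (denom x y)) ((denom x y)^-1 * (1 - y)).
    move=> Dy; apply: (@is_derive1_comp _ (@ln K) (denom ^~ y)).
      exact: is_derive1_ln.
    rewrite (_ : denom ^~ y = fun t => y + (1 - y) * t).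
      exact: is_derive_affine.
    by apply/funext => r; rewrite denomE.
  have dc := dln c Dc; have dd := dln d Dd.
  suff [h1 h2] : is_derive x 1 (fun x => ln (denom x c) - ln (denom x d))
      ((d - c) / (denom x c * denom x d)) by [].
  apply: is_derive_eq; rewrite /denom in Dc Dd *; field.
  by rewrite !gt_eqF.
- move=> x xab; have Dc : 0 < denom x c by apply: Dgt0 => //; rewrite ?lexx ltW.
  have Dd : 0 < denom x d by apply: Dgt0 => //; rewrite ?lexx ltW.
  have dV y : 0 < denom x y -> derivable (fun t => (denom t y)^-1) x 1.
    move=> Dy; rewrite (_ : (fun t => _) = fun t => (denom y t)^-1).
      by have [] := @is_derive_denom_inv y x _ => //; rewrite denomC gt_eqF.
    by apply/funext => r; rewrite denomC.
  have -> : (fun x => (d - c) / (denom x c * denom x d)) =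
    cst (d - c) * ((fun t => (denom t c)^-1) * (fun t => (denom t d)^-1)).
    by apply/funext => r; rewrite /= invfM.
  apply: derivableM; first exact: derivable_cst.
  by apply: derivableM; exact: dV.
Qed.

End Rectangles.

(** * Generating the Borel sets of the plane from half-planes and quadrants *)

Section PlaneSigmaAlgebra.
Context {K : realType}.
Local Notation line := (measurableTypeR K).
Local Notation plane := (line * line)%type.

Lemma sigma_algebra_trace T (D : set T) (S : set (set T)) :
  sigma_algebra D S -> sigma_algebra setT [set C | S (D `&` C)].
Proof.
move=> [S0 SC SU]; split => /=; first by rewrite setI0.
- move=> A SA; rewrite setTD (_ : D `&` ~` A = D `\` (D `&` A)); first exact: SC.
  by rewrite setDIr setDv set0U.
- by move=> A SA; rewrite setI_bigcupr; exact: SU.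
Qed.

Lemma sigma_algebra_preimage_trace T U (f : T -> U) (D : set T) (S : set (set T)) :
  sigma_algebra D S -> sigma_algebra setT [set Y | S (D `&` f @^-1` Y)].
Proof.
move=> /sigma_algebra_trace[S0 SC SU]; split => //=.
- by move=> A /SC; rewrite /= !setTD preimage_setC.
- by move=> A SA; rewrite preimage_bigcup; exact: SU.
Qed.

(** The sets whose trace on [D] lies in [S] form a sigma-algebra, so checking half-planes in each
    coordinate is enough. It serves both for the quadrants and for the sigma-algebra generated by
    the factor. *)
Lemma measurable_plane_ind (D : set plane) (S : set (set plane)) :
  sigma_algebra D S ->
  (forall a, S (D `&` [set z | a < z.1])) ->
  (forall c, S (D `&` [set z | c < z.2])) ->
  forall C, measurable C -> S (D `&` C).
Proof.
move=> SD S1 S2 C mC.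
have ind (f : plane -> line) : (forall a, S (D `&` [set z | a < f z])) ->
    forall Y, measurable Y -> S (D `&` f @^-1` Y).
  move=> Sf Y; rewrite RGenOInfty.measurableE; move: Y.
  apply: smallest_sub; first exact: sigma_algebra_preimage_trace SD.
  move=> _ [a ->]/=; rewrite (_ : f @^-1` _ = [set z | a < f z])//.
  by apply/seteqP; split => z /=; rewrite in_itv/= andbT.
move: C mC; apply: smallest_sub; first exact: sigma_algebra_trace.
by move=> C [[Y mY <-]|[Y mY <-]] /=; rewrite setTI; exact: ind.
Qed.

Definition quadrant (a c : K) : set plane := [set z | a < z.1 /\ c < z.2].

Lemma measurable_quadrant a c : measurable (quadrant a c).
Proof.
rewrite (_ : quadrant a c = `]a, +oo[%classic `*` `]c, +oo[%classic).
  exact: measurableX.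
by apply/seteqP; split => z /=; rewrite !in_itv/= !andbT.
Qed.

Lemma quadrant_cover (z : plane) : exists n, quadrant (- n%:R) (- n%:R) z.
Proof.
exists (Num.truncn (`|z.1| + `|z.2|)).+1.
have h := truncnS_gt (`|z.1| + `|z.2|).
have := ler_norm (- z.1); have := ler_norm (- z.2); rewrite !normrN.
have := normr_ge0 z.1; have := normr_ge0 z.2.
by move=> *; split; lra.
Qed.

Lemma setI_quadrant_cover (Q : set plane) :
  Q = \bigcup_n (Q `&` quadrant (- n%:R) (- n%:R)).
Proof.
apply/seteqP; split => [z Qz|z [n _ []]//].
by have [n nz] := quadrant_cover z; exists n.
Qed.

Lemma quadrantI a c a' c' :
  quadrant a c `&` quadrant a' c' = quadrant (Num.max a a') (Num.max c c').
Proof.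
apply/seteqP; split => z /=; rewrite /quadrant/= !gt_max.
  by move=> [[-> ->] [-> ->]].
by move=> [/andP[-> ->] /andP[-> ->]].
Qed.

(** A half-plane is the countable union of the quadrants obtained by bounding the other coordinate
    below by -n. Quadrants are used because they are stable under intersection. *)
Lemma measurable_plane_quadrant :
  @measurable _ plane = <<s [set Q | exists a c, Q = quadrant a c] >>.
Proof.
apply/seteqP; split; last first.
  apply: smallest_sub; first exact: sigma_algebra_measurable.
  by move=> _ [a [c ->]]; exact: measurable_quadrant.
move=> C mC; rewrite -[C]setTI.
set S := <<s _ >>.
have SS : sigma_algebra setT S by exact: smallest_sigma_algebra.
have Sq a c : S (quadrant a c) by apply: sub_sigma_algebra; exists a, c.
apply: measurable_plane_ind mC => // r; rewrite setTI [X in S X]setI_quadrant_cover.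
- case: SS => _ _; apply => n.
  rewrite (_ : _ `&` _ = quadrant (Num.max r (- n%:R)) (- n%:R)) //.
  by apply/seteqP; split => z; rewrite /quadrant/= gt_max;
    [move=> [-> [-> ->]]|move=> [/andP[-> ->] ->]].
- case: SS => _ _; apply => n.
  rewrite (_ : _ `&` _ = quadrant (- n%:R) (Num.max r (- n%:R))) //.
  by apply/seteqP; split => z; rewrite /quadrant/= gt_max;
    [move=> [-> [-> ->]]|move=> [-> /andP[-> ->]]].
Qed.

End PlaneSigmaAlgebra.

(** * Invariance of mubar *)

Section Invariance.
Context {K : realType}.
Local Notation line := (measurableTypeR K).
Local Notation plane := (line * line)%type.
Local Notation leb := (@lebesgue_measure K).
Local Notation F := (@Farey_ext K).

Lemma mubar_IOmega (B : set plane) : mubar (B `&` Omega) = mubar B.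
Proof. by rewrite /mubar -setIA setIid. Qed.

Lemma mubarU (A B : set plane) : measurable A -> measurable B ->
  A `&` B = set0 -> mubar (A `|` B) = (mubar A + mubar B)%E.
Proof. exact: measureU. Qed.

Lemma ln_cross (p q r s w : K) : 0 < p -> 0 < q -> 0 < r -> 0 < s -> 0 < w ->
  p * s * w = q * r -> ln p - ln q - (ln r - ln s) = - ln w.
Proof.
move=> p0 q0 r0 s0 w0 /(congr1 (@ln K)).
rewrite !lnM ?posrE ?mulr_gt0//; lra.
Qed.

Definition corner (a c : K) : set plane := `]a, 1] `*` `]c, 1].

(** D equals 1 whenever one coordinate is 1, so only the lower left corner contributes to the
    cross-ratio. *)
Lemma mubar_corner a c : 0 < a -> a < 1 -> 0 < c -> c < 1 ->
  mubar (corner a c) = (- ln (denom a c))%:E.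
Proof.
move=> a0 a1 c0 c1; rewrite /corner mubar_rect//; last exact: ltW.
congr EFin; apply: ln_cross; try (by apply: denom_gt0; lra).
rewrite /denom; ring.
Qed.

Lemma mubar_Farey_corner a c : 0 < a -> a < 1 -> 0 < c -> c < 1 ->
  mubar (F @^-1` corner a c) = (- ln (denom a c))%:E.
Proof.
move=> a0 a1 c0 c1.
have a10 : 0 < 1 + a by lra.
have D0 : 0 < denom a c by apply: denom_gt0; lra.
have [x2h x21] : 2^-1 < (1 + a)^-1 /\ (1 + a)^-1 <= 1.
  by rewrite ltf_pV2 ?posrE ?invf_le1//; split; lra.
rewrite -mubar_IOmega; have [ch|ch] := leP 2^-1 c.
  have ci1 : 1 < c^-1 by rewrite invf_gt1.
  have ci2 : c^-1 <= 2 by rewrite -[leRHS]invrK lef_pV2 ?posrE.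
  (* The left branch has second coordinate at most 1/2, so for c >= 1/2 only the right branch
     reaches the corner. *)
  have -> : F @^-1` corner a c `&` Omega =
      `]2^-1, (1 + a)^-1[ `*` `[0, c^-1 - 1[.
    apply/seteqP; split => [[x y]|[x y]]; rewrite /corner /= !in_itv/=.
      move=> [+ /OmegaP[/= x0 x1 y0 y1]]; rewrite /Farey_ext/=.
      have yp : 0 < 1 + y by lra.
      case: (leP x 2^-1) => xh /= [/andP[h1 h2] /andP[h3 h4]].
        by move: h3; rewrite ltr_pdivlMr//; nra.
      have xp : 0 < x by lra.
      move: h1 h3; rewrite !ltr_pdivlMr// => h1 h3.
      split; first by rewrite -div1r ltr_pdivlMr//; lra.
      by apply/andP; split => //; rewrite ltrBrDr -div1r ltr_pdivlMr//; lra.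
    move=> [/andP[h1 h2] /andP[h3 h4]].
    have xp : 0 < x by lra.
    have yp : 0 < 1 + y by lra.
    split; last first.
      by apply/OmegaP; split => /=; lra.
    rewrite /Farey_ext/= (lt_geF h1)/= !ltr_pdivlMr// !ler_pdivrMr//.
    move: h2 h4; rewrite -div1r ltr_pdivlMr// ltrBrDr -div1r ltr_pdivlMr// => h2 h4.
    by split; apply/andP; split; lra.
  rewrite mubar_rect; [|lra ..].
  congr EFin; apply: ln_cross => //; try (by apply: denom_gt0; rewrite ?invr_gt0//; lra).
  rewrite /denom; field; lra.
have c1p : 0 < 1 - c by lra.
(* For c < 1/2 both branches contribute; on the right branch the condition on y always holds, up to
   the endpoint conventions. *)
have -> : F @^-1` corner a c `&` Omega =
  (`]a / (1 + a), 2^-1] `*` `]c / (1 - c), 1]) `|`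
  (`]2^-1, (1 + a)^-1[ `*` `[0, 1]).
  apply/seteqP; split => [[x y]|[x y]]; rewrite /corner /= !in_itv/=.
    move=> [+ /OmegaP[/= x0 x1 y0 y1]]; rewrite /Farey_ext/=.
    have yp : 0 < 1 + y by lra.
    case: (leP x 2^-1) => xh /= [/andP[h1 h2] /andP[h3 h4]].
      have xp : 0 < 1 - x by lra.
      left; move: h1 h3; rewrite !ltr_pdivlMr// => h1 h3.
      rewrite andbT y1 andbT; split; rewrite ltr_pdivrMr//; lra.
    have xp : 0 < x by lra.
    right; move: h1 h3; rewrite !ltr_pdivlMr// => h1 h3.
    split; last exact/andP.
    by rewrite -div1r ltr_pdivlMr//; lra.
  move=> [] [/andP[h1 h2] /andP[h3 h4]].
    have a1p : 0 < a / (1 + a) by rewrite divr_gt0.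
    have c2p : 0 < c / (1 - c) by rewrite divr_gt0.
    split; last by apply/OmegaP; split => /=; lra.
    have xp : 0 < 1 - x by lra.
    have yp : 0 < 1 + y by lra.
    move: h1 h3; rewrite !ltr_pdivrMr// => h1 h3.
    rewrite /Farey_ext/= h2/= !ltr_pdivlMr// !ler_pdivrMr//.
    by split; apply/andP; split; lra.
  have xp : 0 < x by lra.
  have yp : 0 < 1 + y by lra.
  split; last by apply/OmegaP; split => /=; lra.
  rewrite /Farey_ext/= (lt_geF h1)/= !ltr_pdivlMr// !ler_pdivrMr//.
  move: h2; rewrite -div1r ltr_pdivlMr// => h2.
  by split; apply/andP; split; nra.
have a1p : 0 < a / (1 + a) by rewrite divr_gt0.
have c2p : 0 < c / (1 - c) by rewrite divr_gt0.
have a1h : a / (1 + a) < 2^-1 by rewrite ltr_pdivrMr//; lra.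
have c21 : c / (1 - c) < 1 by rewrite ltr_pdivrMr//; lra.
rewrite mubarU; [|exact: measurableX|exact: measurableX|]; last first.
  apply/seteqP; split => // -[x y]; rewrite /= !in_itv/= => -[[/andP[_ h] _]].
  by move=> [/andP[h' _] _]; lra.
do 2 (rewrite mubar_rect; [|lra ..]).
rewrite -EFinD; congr EFin.
(* The two rectangles have cross-ratios 2 D(a, c)/(1 + a) and (1 + a)/2, whose product is D(a,
   c). *)
rewrite (@ln_cross _ _ _ _ (2 * denom a c / (1 + a)))//;
  try (by apply: denom_gt0; lra); last 2 first.
- by rewrite divr_gt0// mulr_gt0.
- rewrite /denom; field; lra.
rewrite (@ln_cross _ _ _ _ ((1 + a) / 2))//;
  try (by apply: denom_gt0; lra); last first.
- rewrite /denom; field; lra.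
- by rewrite divr_gt0.
rewrite -opprD -lnM ?posrE ?divr_gt0 ?mulr_gt0//; congr (- ln _).
field; lra.
Qed.

Lemma mubar_null (N : set plane) : measurable N ->
  (leb \x leb)%E N = 0%E -> mubar N = 0%E.
Proof.
move=> mN N0; have mNO : measurable (N `&` Omega).
  by apply: measurableI => //; exact: measurable_Omega.
apply: null_set_integral => //.
  apply: measurable_funTS; apply/measurable_EFinP.
  exact: measurable_mubar_density.
by apply: (subset_measure0 mNO mN) => // z [].
Qed.

Lemma mubarXT_null (N : set line) : measurable N -> leb N = 0%E ->
  mubar (N `*` setT) = 0%E /\ mubar (setT `*` N) = 0%E.
Proof.
move=> mN N0; split; apply: mubar_null; try exact: measurableX.
- by rewrite product_measure1E// [X in (X * _)%E](_ : _ = 0%E) ?mul0e.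
- by rewrite product_measure1E// [X in (_ * X)%E](_ : _ = 0%E) ?mule0.
Qed.

(** The rest of [Omega] lies on lines with a rational coordinate, a Lebesgue-null set. *)
Lemma mubar_good (B : set plane) : measurable B -> mubar (B `&` good) = mubar B.
Proof.
move=> mB; rewrite -[in RHS]mubar_IOmega.
have mQ := @measurable_rational K.
have [Q1 Q2] := mubarXT_null mQ (countable_lebesgue_measure0 countable_rational).
rewrite (_ : B `&` Omega = (B `&` good) `|` (B `&` Omega `\` good)); last first.
  apply/seteqP; split => [z [Bz Oz]|z [[Bz [Oz _]]|[]//]//].
  by have [gz|gz] := pselect (good z); [left|right].
have mO := @measurable_Omega K; have mG := @measurable_good K.
have mBO : measurable (B `&` Omega `\` good).
  by apply: measurableD => //; exact: measurableI.
rewrite mubarU//; last 2 first.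
- exact: measurableI.
- by apply/seteqP; split => // z [[_ ?] []].
rewrite [X in (_ + X)%E](_ : _ = 0%E) ?adde0//.
apply/eqP; rewrite eq_le measure_ge0 andbT.
rewrite (@le_trans _ _ (mubar (rational `*` setT `|` setT `*` rational : set plane)))//.
  apply: le_measure; rewrite ?inE//; first by apply: measurableU; exact: measurableX.
  move=> z [[Bz Oz] gz]; apply: contrapT => h; apply: gz.
  by split => //; split => ?; apply: h; [left|right].
have h : (mubar (rational `*` setT `|` setT `*` rational : set plane) <=
    mubar (rational `*` setT : set plane) + mubar (setT `*` rational : set plane))%E.
  by apply: measureU2; exact: measurableX.
by rewrite (le_trans h)// Q1 Q2 adde0.
Qed.

Lemma quadrant_corner a c e : quadrant a c `&` corner e e =
  corner (Num.max a e) (Num.max c e) :> set plane.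
Proof.
apply/seteqP; split => z; rewrite /corner/= !in_itv/= !gt_max.
  by move=> [[-> ->] [/andP[-> ->] /andP[-> ->]]].
by move=> [/andP[/andP[az ->] ->] /andP[/andP[cz ->] ->]].
Qed.

Lemma corner_set0 a c : 1 <= a \/ 1 <= c -> corner a c = set0.
Proof.
move=> h; apply/seteqP; split => // z; rewrite /corner/= !in_itv/=.
by move=> [/andP[? ?] /andP[? ?]]; case: h => ?; lra.
Qed.

Lemma measurable_corner a c : measurable (corner a c).
Proof. exact: measurableX. Qed.

Lemma measurable_Farey_preimage (B : set plane) : measurable B ->
  measurable (F @^-1` B).
Proof.
by move=> mB; rewrite -[X in measurable X]setTI; exact: measurable_Farey_ext.
Qed.

(* Measures are compared on [corner e e] because [mubar] is infinite near the
   origin, so that quadrants alone do not have finite measure. *)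
Lemma mubar_Farey_preimage_corner (B : set plane) e : 0 < e -> measurable B ->
  mubar (F @^-1` (B `&` corner e e)) = mubar (B `&` corner e e).
Proof.
move=> e0 mB; have mC := measurable_corner e e.
have mFC := measurable_Farey_preimage mC.
pose m1 := mrestr mubar mC.
pose m2 := pushforward (mrestr mubar mFC) F.
suff : m1 B = m2 B by [].
have key a c : m1 (quadrant a c) = m2 (quadrant a c) /\ (m1 (quadrant a c) < +oo)%E.
  rewrite /m2 /pushforward /m1 /mrestr -preimage_setI quadrant_corner.
  have [a1|a1] := leP 1 (Num.max a e).
    by rewrite corner_set0 ?preimage_set0 ?measure0//; left.
  have [c1|c1] := leP 1 (Num.max c e).
    by rewrite corner_set0 ?preimage_set0 ?measure0//; right.
  rewrite mubar_corner ?mubar_Farey_corner ?ltry//; rewrite lt_max e0 orbT//.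
apply: (measure_unique [set Q | exists a c, Q = quadrant a c]
  (fun n => quadrant (- n%:R) (- n%:R))) => //.
- exact: measurable_plane_quadrant.
- by move=> _ _ [a [c ->]] [a' [c' ->]]; rewrite quadrantI; do 2 eexists.
- by move=> n; do 2 eexists.
- by rewrite -subTset => z _; have [n] := quadrant_cover z; exists n.
- exact: measurable_Farey_ext.
- by move=> ? _ [a [c ->]]; have [] := key a c.
- by move=> n; have [] := key (- n%:R) (- n%:R).
Qed.

Lemma mubar_Farey_preimage (B : set plane) : measurable B ->
  mubar (F @^-1` B) = mubar B.
Proof.
move=> mB; have mG := @measurable_good K.
have mBG : measurable (B `&` good) by exact: measurableI.
rewrite -mubar_good; last exact: measurable_Farey_preimage.
rewrite -[RHS]mubar_good//.
transitivity (mubar (F @^-1` (B `&` good))).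
  rewrite -[RHS]mubar_good; last exact: measurable_Farey_preimage.
  congr mubar; apply/seteqP; split => z [].
    by move=> Bz gz; split => //; split => //; exact: good_Farey_ext.
  by move=> [Bz _] gz.
(* The corners at (1/(n + 2), 1/(n + 2)) increase and exhaust the good points, whose coordinates are
   positive; continuity from below removes the restriction to corners. *)
pose e n : K := n.+2%:R^-1.
pose C n := B `&` good `&` corner (e n) (e n).
have mC n : measurable (C n) by apply: measurableI => //; exact: measurable_corner.
have CE : B `&` good = \bigcup_n C n.
  apply/seteqP; split => [z [Bz gz]|z [n _ []//]].
  have /goodP[/andP[x0 x1] /andP[y0 y1] _ _] := gz.
  exists (Num.truncn (z.1^-1 + z.2^-1)) => //; split => //.
  rewrite /corner/= !in_itv/= !(ltW x1) !(ltW y1) !andbT.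
  have h := truncnS_gt (z.1^-1 + z.2^-1).
  have xi : 0 < z.1^-1 by rewrite invr_gt0.
  have yi : 0 < z.2^-1 by rewrite invr_gt0.
  rewrite /e -[ltRHS]invrK -[X in _ /\ (_ < X)]invrK !ltf_pV2 ?posrE//.
  by move: h; rewrite -!natr1; split; lra.
have ndC : nondecreasing_seq C.
  move=> m n mn; apply/subsetPset => z [BGz]; rewrite /corner/= !in_itv/=.
  move=> [/andP[h1 h2] /andP[h3 h4]]; split => //.
  rewrite /corner/= !in_itv/= h2 h4 !andbT.
  have enm : e n <= e m by rewrite /e lef_pV2 ?posrE// ler_nat.
  by split; exact: le_lt_trans enm _.
have h1 : mubar (C n) @[n --> \oo] --> mubar (\bigcup_n C n).
  by apply: nondecreasing_cvg_mu => //; rewrite -CE.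
have h2 : mubar (F @^-1` (C n)) @[n --> \oo] --> mubar (\bigcup_n F @^-1` C n).
  apply: (@nondecreasing_cvg_mu _ _ _ mubar (fun n => F @^-1` (C n))).
  - by move=> n; exact: measurable_Farey_preimage.
  - by rewrite -preimage_bigcup -CE; exact: measurable_Farey_preimage.
  - move=> m n mn; apply/subsetPset; apply: preimage_subset.
    by apply/subsetPset; exact: ndC.
have e12 : (fun n => mubar (F @^-1` (C n))) = (fun n => mubar (C n)).
  by apply/funext => n; apply: mubar_Farey_preimage_corner => //; rewrite invr_gt0.
rewrite e12 -preimage_bigcup -CE in h2; rewrite -CE in h1.
exact: (cvg_unique _ h2 h1).
Qed.

(** Injectivity on good points identifies the preimage of the image with the set itself, so
    invariance passes from preimages to images. *)
Lemma mubar_Farey_image (B : set plane) : measurable B -> B `<=` good ->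
  mubar (F @` B) = mubar B.
Proof.
move=> mB BG.
have [mFB _] := Farey_ext_stable_images mB (fun z h => (BG z h).1).
rewrite -mubar_Farey_preimage// -mubar_good; last exact: measurable_Farey_preimage.
congr mubar; apply/seteqP; split => [z [[w Bw wz] gz]|z Bz].
  by rewrite -(Farey_ext_inj (BG _ Bw) gz wz).
by split; [exists z|exact: BG].
Qed.

Lemma mubar_iter_image n (B : set plane) : measurable B -> B `<=` good ->
  mubar (iter n F @` B) = mubar B.
Proof.
move=> mB BG; elim: n => [|n IH]; first by rewrite image_id.
have [mI _] := stable_images_iter n Farey_ext_stable_images mB
  (fun z h => (BG z h).1).
rewrite (_ : iter n.+1 F @` B = F @` (iter n F @` B)); last by rewrite -image_comp.
rewrite mubar_Farey_image// => _ [z /BG gz <-]; exact: good_iter.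
Qed.

Lemma lebesgue_Omega : (leb \x leb)%E (@Omega K) = 1%E.
Proof.
rewrite product_measure1E//.
have h : leb (`[0, 1]%classic : set line) = 1%E.
  by rewrite lebesgue_measure_itv/= lte_fin ltr01 oppr0 adde0.
by rewrite [X in (X * _)%E](_ : _ = 1%E)// [X in (_ * X)%E](_ : _ = 1%E)// mul1e.
Qed.

Lemma mubar_le (B : set plane) (M : K) : 0 <= M -> measurable B ->
  (forall z, B z -> Omega z -> mubar_density z <= M) -> (mubar B <= M%:E)%E.
Proof.
move=> M0 mB BM; have mO := @measurable_Omega K.
have mBO : measurable (B `&` Omega) by exact: measurableI.
rewrite -[leRHS]mule1 -lebesgue_Omega.
apply: (@le_trans _ _ (M%:E * (leb \x leb) (B `&` Omega))%E).
  rewrite -integral_cst// /mubar; apply: ge0_le_integral => //.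
  - by move=> z _; rewrite lee_fin divr_ge0// sqr_ge0.
  - apply: measurable_funTS; apply/measurable_EFinP.
    exact: measurable_mubar_density.
  - by move=> z [Bz Oz]; rewrite lee_fin; exact: BM.
apply: lee_pmul => //; apply: le_measure; rewrite ?inE//.
Qed.

Lemma mubar_ge (B : set plane) : measurable B -> B `<=` Omega ->
  (forall z, B z -> 0 < z.1) -> ((leb \x leb) B <= mubar B)%E.
Proof.
move=> mB BO B0; rewrite /mubar (setIidl BO).
rewrite -[leLHS]mul1e -integral_cst//; apply: ge0_le_integral => //.
- apply: measurable_funTS; apply/measurable_EFinP.
  exact: measurable_mubar_density.
- move=> z Bz; rewrite lee_fin /mubar_density.
  have /OmegaP[x0 x1 y0 y1] := BO z Bz; have xp := B0 z Bz.
  have D0 := denom_gt0 xp x1 y0 y1; rewrite /denom in D0.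
  have D1 : z.1 + z.2 - z.1 * z.2 <= 1 by nra.
  by rewrite ler_pdivlMr ?exprn_gt0// mul1r expr_le1// ltW.
Qed.

End Invariance.

(** * The return time to the domain *)

Section ReturnTime.
Context {K : realType}.
Local Notation line := (measurableTypeR K).
Local Notation plane := (line * line)%type.
Local Notation F := (@Farey_ext K).
Local Notation T := (@F_H1 K).
Implicit Types (z w v : plane) (x : line) (l n : nat).

Lemma digit_bounds x : 0 < x -> (digit x)%:R * x <= 1 < (digit x).+1%:R * x.
Proof.
move=> x0; have x1 : 0 <= x^-1 by rewrite invr_ge0 ltW.
have /andP[h1 h2] := truncn_itv x1.
by rewrite -ler_pdivlMr// -ltr_pdivrMr// div1r h1.
Qed.

Lemma digit_eq x n : 0 < x -> n%:R * x <= 1 -> 1 < n.+1%:R * x -> digit x = n.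
Proof.
move=> x0 h1 h2; apply: truncn_def.
by rewrite -[_ x]div1r ler_pdivlMr// h1 ltr_pdivrMr.
Qed.

Lemma digit_gt0 x : 0 < x -> x <= 1 -> (0 < digit x)%N.
Proof.
move=> x0 x1; rewrite lt0n; apply/eqP => d0.
by have /andP[_] := digit_bounds x0; rewrite d0 mul1r ltNge x1.
Qed.

(** Since l < a(x) gives (l + 1)x <= 1, the first l steps all use the left branch, whose iterates
    are explicit. *)
Lemma iter_Farey z l : Omega z -> (l < digit z.1)%N ->
  iter l F z = (z.1 / (1 - l%:R * z.1), z.2 / (1 + l%:R * z.2)).
Proof.
move=> /OmegaP[x0 x1 y0 y1].
elim: l => [|l IH] ld.
  by rewrite /= !mul0r subr0 addr0 !divr1 -surjective_pairing.
(* The convention [digit 0 = 0] excludes a zero first coordinate here. *)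
have x0' : 0 < z.1.
  rewrite lt_neqAle x0 andbT; apply/eqP => z10.
  by move: ld; rewrite -z10 /digit invr0 truncn0.
have /andP[dx _] := digit_bounds x0'.
have lx : l%:R * z.1 + 2 * z.1 <= 1.
  rewrite -mulrDl -natrD; apply: le_trans dx; rewrite ler_wpM2r// ler_nat; lia.
have lx0 : 0 <= l%:R * z.1 by rewrite mulr_ge0.
have ly0 : 0 <= l%:R * z.2 by rewrite mulr_ge0.
have D0 : 0 < 1 - l%:R * z.1 by lra.
rewrite iterS IH; last exact: ltnW.
rewrite /Farey_ext/= ler_pdivrMr// ifT; last lra.
rewrite -natr1 !mulrDl !mul1r; congr pair; field.
  apply/andP; split; lra.
apply/andP; split; lra.
Qed.

(** Already one left step brings the second coordinate down to y/(1 + y) <= 1/2. *)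
Lemma iter_Farey_notin_H1 z l : Omega z -> (0 < l)%N -> (l < digit z.1)%N ->
  ~ H1 (iter l F z).
Proof.
move=> Oz l0 ld [_]; rewrite iter_Farey// /= in_itv/= => /andP[+ _].
move/OmegaP : Oz => [x0 x1 y0 y1].
have l1 : 1 <= l%:R :> K by rewrite ler1n.
have ly : z.2 <= l%:R * z.2 by nra.
by rewrite ltr_pdivlMr; lra.
Qed.

Lemma le_iter_Farey_fst z l : Omega z -> (l < digit z.1)%N ->
  z.1 <= (iter l F z).1.
Proof.
move=> Oz ld; rewrite iter_Farey//=; move/OmegaP : Oz => [x0 x1 y0 y1].
have x0' : 0 < z.1.
  rewrite lt_neqAle x0 andbT; apply/eqP => z10.
  by move: ld; rewrite -z10 /digit invr0 truncn0.
have /andP[dx _] := digit_bounds x0'.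
have lx : l%:R * z.1 + z.1 <= 1.
  rewrite -[X in _ + X]mul1r -mulrDl natr1; apply: le_trans dx.
  by rewrite ler_wpM2r// ler_nat.
have lx0 : 0 <= l%:R * z.1 by rewrite mulr_ge0.
by rewrite ler_pdivlMr; nra.
Qed.

(** This decides the branch: among the first a(x) steps, only the last one uses the right branch. *)
Lemma iter_Farey_fst_le z l : good z -> (l < digit z.1)%N ->
  ((iter l F z).1 <= 2^-1) = (l.+1 < digit z.1)%N.
Proof.
move=> gz ld; have [Oz _] := gz; have /goodP[/andP[x0 x1] _ _ _] := gz.
have /andP[dx dx1] := digit_bounds x0.
have lx : l%:R * z.1 + z.1 <= 1.
  rewrite -[X in _ + X]mul1r -mulrDl natr1; apply: le_trans dx.
  by rewrite ler_pM2r// ler_nat.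
have D0 : 0 < 1 - l%:R * z.1 by lra.
rewrite iter_Farey//= ler_pdivrMr//; apply/idP/idP => h.
  have : l.+2%:R * z.1 < (digit z.1).+1%:R * z.1.
    by apply: le_lt_trans dx1; rewrite -addn2 natrD mulrDl; lra.
  by rewrite ltr_pM2r// ltr_nat ltnS.
have : l.+2%:R * z.1 <= 1.
  by apply: le_trans dx; rewrite ler_pM2r// ler_nat.
by rewrite -addn2 natrD mulrDl; lra.
Qed.

Lemma good_F_H1 z : good z -> good (T z).
Proof. exact: good_iter. Qed.

Lemma good_F_H1_inv z : Omega z -> good (T z) -> good z.
Proof. exact: good_iter_inv. Qed.

Lemma digit_good_gt0 z : good z -> (0 < digit z.1)%N.
Proof. by move=> /goodP[/andP[x0 x1] _ _ _]; exact: digit_gt0 x0 (ltW x1). Qed.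

Lemma F_H1E z : good z -> T z = F (iter (digit z.1).-1 F z).
Proof. by move=> gz; rewrite -iterS prednK// digit_good_gt0. Qed.

(** On first coordinates the induced map on [H1] is the Gauss map. *)
Lemma F_H1_fst z : good z -> (T z).1 = z.1^-1 - (digit z.1)%:R.
Proof.
move=> gz; have d0 := digit_good_gt0 gz; have [Oz _] := gz.
have /goodP[/andP[x0 x1] _ _ _] := gz; have /andP[dx _] := digit_bounds x0.
have ld : ((digit z.1).-1 < digit z.1)%N by rewrite prednK.
rewrite F_H1E//; have := iter_Farey_fst_le gz ld; rewrite prednK// ltnn.
rewrite iter_Farey// /Farey_ext/= => -> /=.
have -> : (digit z.1)%:R = (digit z.1).-1%:R + 1 :> K by rewrite natr1 prednK.
have : ((digit z.1).-1%:R + 1) * z.1 <= 1 by rewrite natr1 prednK.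
move=> h; field; lra.
Qed.

Lemma F_H1_H1 z : good z -> H1 (T z).
Proof.
move=> gz; have d0 := digit_good_gt0 gz.
have ld : ((digit z.1).-1 < digit z.1)%N by rewrite prednK.
have /goodP[/andP[u0 u1] /andP[v0 v1] _ _] := good_F_H1 gz.
split; rewrite /= in_itv/= ?(ltW u0) ?(ltW u1)// ?(ltW v1) andbT.
rewrite F_H1E//; have := iter_Farey_fst_le gz ld; rewrite prednK// ltnn.
have /goodP[_ /andP[y0 y1] _ _] := good_iter (digit z.1).-1 gz.
by rewrite /Farey_ext => -> /=; rewrite ltr_pdivlMr; lra.
Qed.

(** Each good point has at most one base in the tower over [H1]: if the heights differed, cancelling
    the common iterates would put one base strictly inside the tower over the other, hence outside
    [H1]. *)
Lemma iter_Farey_rep z w l m : good z -> good w -> H1 z -> H1 w ->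
  (l < digit z.1)%N -> (m < digit w.1)%N -> iter l F z = iter m F w -> z = w.
Proof.
have le_case z' w' l' m' : good z' -> good w' -> H1 z' -> (m' < digit w'.1)%N ->
    (l' <= m')%N -> iter l' F z' = iter m' F w' -> z' = w'.
  move=> gz gw Hz md lm; rewrite -{1}(subnKC lm) iterD.
  move/(iter_inj gz (good_iter _ gw)) => zw.
  case: (posnP (m' - l')) => [ml0|ml0]; first by rewrite zw ml0.
  rewrite zw in Hz; case: (iter_Farey_notin_H1 gw.1 ml0 _ Hz).
  exact: leq_ltn_trans (leq_subr _ _) md.
move=> gz gw Hz Hw ld md; case: (leqP l m) => [|/ltnW] lm e.
  exact: le_case lm e.
by apply/esym/le_case; [exact: gw|exact: gz|done|exact: ld|exact: lm|].
Qed.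

Lemma F_H1_inj z w : good z -> good w -> H1 z -> H1 w -> T z = T w -> z = w.
Proof.
move=> gz gw Hz Hw; rewrite !F_H1E// => /Farey_ext_inj e.
apply: (iter_Farey_rep gz gw Hz Hw) (e _ _); try exact: good_iter.
  by rewrite prednK// digit_good_gt0.
by rewrite prednK// digit_good_gt0.
Qed.

Variable alpha : K.
Local Notation A := (setA alpha).
Local Notation R := (domR alpha).
Local Notation hit := (@hit_set K alpha).

Lemma past_hitP z j : past_hit alpha z = Some j <->
  [/\ (0 < j)%N, hit j z & forall i, (0 < i < j)%N -> ~ hit i z].
Proof.
rewrite inf_nat_Some; split=> [[[j0 hj] jP]|[j0 hj jP]]; split => //.
  by move=> i /andP[i0 ij] hi; exact: jP ij _.
by move=> i ij [i0 hi]; apply: (jP i _ hi); rewrite i0.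
Qed.

Lemma hit1 z : good z -> H1 z -> hit 1 (T z) <-> z.1 < alpha.
Proof.
move=> gz Hz; split=> [[w [Hw [/= wa _]] wz]|za].
  have gw : good w by apply: good_F_H1_inv (H1_Omega Hw) _; rewrite wz; exact: good_F_H1.
  by rewrite -(F_H1_inj gw gz Hw Hz wz); move: wa; rewrite in_itv/= => /andP[].
exists z => //; split => //; case: Hz; rewrite /= !in_itv/=.
by move=> /andP[-> _] /andP[h ->]; rewrite za (ltW h).
Qed.

(** Injectivity of [F_H1] cancels one step. The index [j.+2] guarantees that the point compared with
    [z] is itself an image under [F_H1], hence in [H1]. *)
Lemma hitS z j : good z -> H1 z -> hit j.+2 (T z) -> hit j.+1 z.
Proof.
move=> gz Hz [w [Hw bw] wz]; exists w => //.
have Oi i : Omega (iter i T w).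
  elim: i => [|i IH]; first exact: H1_Omega.
  by rewrite iterS; exact: Omega_iter.
have gi i : good (iter i.+1 T w) -> good (iter i T w).
  by rewrite iterS => /good_F_H1_inv; apply.
have gv : good (iter j.+1 T w) by apply: gi; rewrite wz; exact: good_F_H1.
apply: F_H1_inj => //; rewrite iterS; apply: F_H1_H1; exact: gi.
Qed.

Lemma hitS_inv z j : hit j z -> hit j.+1 (T z).
Proof. by move=> [w Hw wz]; exists w => //=; rewrite wz. Qed.

Lemma past_hit_F_H1_lt z : good z -> H1 z -> z.1 < alpha ->
  past_hit alpha (T z) = Some 1%N.
Proof.
move=> gz Hz za; apply/past_hitP; split => //; first exact/hit1.
by case=> [|[]].
Qed.

(** A hit at time 1 would force x < alpha, and all later hits of the image are hits of [z] delayed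
    by one. *)
Lemma past_hit_F_H1_ge z j : good z -> H1 z -> alpha <= z.1 ->
  past_hit alpha z = Some j -> past_hit alpha (T z) = Some j.+1.
Proof.
move=> gz Hz za /past_hitP[j0 hj jP]; apply/past_hitP; split => //.
  exact: hitS_inv.
case=> [|[|i]]// ij; first by move=> /hit1 -/(_ gz Hz); rewrite ltNge za.
by move=> /(hitS gz Hz); exact: jP.
Qed.

Lemma setA_F_H1_lt z : good z -> H1 z -> z.1 < alpha -> A (T z).
Proof.
move=> gz Hz za; split; first exact: F_H1_H1.
by exists 1%N => //; exact: past_hit_F_H1_lt.
Qed.

(** The parity of k flips to even after one step. After the second step, k is either reset to 1 or
    increased to k(z) + 2, odd in both cases. *)
Lemma setA_F_H1_ge z : good z -> A z -> alpha <= z.1 ->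
  ~ A (T z) /\ A (T (T z)).
Proof.
move=> gz [Hz [j jz oj]] za.
have jT := past_hit_F_H1_ge gz Hz za jz.
split; first by move=> [_ [i]]; rewrite jT => -[<-]/=; rewrite oj.
have gT := good_F_H1 gz; have HT := F_H1_H1 gz.
have [za'|za'] := ltP (T z).1 alpha; first exact: setA_F_H1_lt.
split; first exact: F_H1_H1.
exists j.+2 => //=; last by rewrite negbK.
exact: past_hit_F_H1_ge.
Qed.

(** On good points the index a of the union is the digit of the base point, so [domR] is [A]
    together with the higher tower levels over its part with x >= alpha. *)
Lemma domRP z : good z -> R z <->
  A z \/ exists w l, [/\ good w, A w, alpha <= w.1, (0 < l < digit w.1)%N &
                        z = iter l F w].
Proof.
move=> gz; split.
  move=> [Az|[a /= a1 [l /= /andP[l0 la] [w [[Aw Vw] [aw _]] wz]]]]; [by left|right].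
  have gw : good w by apply: (good_iter_inv (n := l) (H1_Omega Aw.1)); rewrite wz.
  exists w, l; split => //.
    by move: aw; rewrite /= in_itv/= => /andP[].
  have /goodP[/andP[x0 x1] _ _ _] := gw.
  suff -> : digit w.1 = a by rewrite l0; lia.
  have a0 : 0 < a%:R :> K by rewrite ltr0n; lia.
  move: Vw => [/= + _]; rewrite in_itv/= => /andP[h1 h2].
  apply: digit_eq => //.
    by move: h2; rewrite -div1r ler_pdivlMr// mulrC.
  by move: h1; rewrite -div1r ltr_pdivrMr// mulrC.
move=> [Az|[w [l [gw Aw aw /andP[l0 ld] ->]]]]; [by left|right].
exists (digit w.1) => /=; first exact: leq_ltn_trans ld.
exists l => /=; first by rewrite l0; lia.
have /goodP[/andP[x0 x1] /andP[y0 y1] _ _] := gw.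
exists w => //; split; first split => //.
  have /andP[h1 h2] := digit_bounds x0; have d0 := digit_good_gt0 gw.
  rewrite /cylV /= !in_itv/= (ltW y0) (ltW y1); split => //.
  rewrite -[X in X < _]div1r -[X in _ <= X]div1r ltr_pdivrMr//.
  by rewrite ler_pdivlMr ?ltr0n// ![w.1 * _]mulrC h1 h2.
have [_ /=] := Aw.1; rewrite !in_itv/= => /andP[h1 h2].
by rewrite aw (ltW x1) (ltW h1) h2.
Qed.

(** By uniqueness of the base, the tower over [z] can meet [domR alpha] only at its ground level in
    [A], or because [z] is itself in [A] with x >= alpha. *)
Lemma notin_domR z l : good z -> H1 z -> (l < digit z.1)%N ->
  (l = 0%N -> ~ A z) -> ~ A z \/ z.1 < alpha -> ~ R (iter l F z).
Proof.
move=> gz Hz ld l0A Aza /(domRP (good_iter _ gz))[Al|].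
  case: l => [|l] in ld l0A Al *; first exact: l0A.
  exact: iter_Farey_notin_H1 gz.1 _ ld Al.1.
move=> [w [m [gw Aw aw /andP[m0 md] lm]]].
have e := iter_Farey_rep gz gw Hz Aw.1 ld md lm.
by rewrite e in Aza; case: Aza => //; rewrite ltNge aw.
Qed.

(* The return time to [domR alpha] depends on the first coordinate only. *)
Definition ret x : nat :=
  if x < alpha then digit x
  else if x <= 2^-1 then 1%N else (digit ((1 - x) / x)).+1.

Lemma first_returnP z n : first_return F R z = Some n <->
  [/\ (0 < n)%N, R (iter n F z) & forall m, (0 < m < n)%N -> ~ R (iter m F z)].
Proof.
rewrite inf_nat_Some; split=> [[[j0 hj] jP]|[j0 hj jP]]; split => //.
  by move=> i /andP[i0 ij] hi; exact: jP ij _.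
by move=> i ij [i0 hi]; apply: (jP i _ hi); rewrite i0.
Qed.

Lemma first_return_ret z : good z -> R z ->
  first_return F R z = Some (ret z.1).
Proof.
move=> gz Rz; apply/first_returnP.
(* This covers both a point of [A] with x >= alpha (l = 0) and a point on a higher level over such a
   base. *)
have case_ge w l : good w -> A w -> alpha <= w.1 -> (l < digit w.1)%N ->
    z = iter l F w ->
    [/\ (0 < ret z.1)%N, R (iter (ret z.1) F z) &
      forall m, (0 < m < ret z.1)%N -> ~ R (iter m F z)].
  move=> gw Aw aw ld zw.
  have za : (z.1 < alpha) = false.
    by apply/negbTE; rewrite -leNgt zw (le_trans aw)// le_iter_Farey_fst//; exact: gw.1.
  have zh := iter_Farey_fst_le gw ld; rewrite -zw in zh.
  rewrite /ret za zh; case: ifPn => ld'.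
    split => //; last by case=> [|[]].
    by apply/(domRP (good_iter 1 gz)); right; exists w, l.+1; rewrite zw.
  (* Here [z] is at the top of its tower. The next tower stands over [T w], which is outside [A],
     and is skipped entirely; the orbit comes back at [T (T w)]. *)
  have Fz : F z = T w.
    rewrite zw F_H1E// -iterS; congr (F (iter _ F w)); move: ld' ld; lia.
  have gv : good (T w) := good_F_H1 gw; have Hv := F_H1_H1 gw.
  have [nAv AT] := setA_F_H1_ge gw Aw aw.
  have Fz1 : (1 - z.1) / z.1 = (T w).1 by rewrite -Fz /Farey_ext zh (negbTE ld').
  rewrite Fz1; split => //.
    by rewrite iterSr Fz; left.
  case=> // m /andP[_ md]; rewrite iterSr Fz.
  by apply: notin_domR => //; left.
move/(domRP gz) : (Rz) => [Az|[w [l [gw Aw aw /andP[_ ld] zw]]]].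
  have [za|za] := ltP z.1 alpha; last first.
    by apply: (case_ge z 0%N) => //; exact: digit_good_gt0.
  rewrite /ret za; split; first exact: digit_good_gt0.
    by left; apply: setA_F_H1_lt => //; exact: Az.1.
  move=> m /andP[m0 md]; apply: notin_domR => //; [exact: Az.1| |by right].
  by move=> e; rewrite e in m0.
exact: case_ge zw.
Qed.

End ReturnTime.

(** * The induced system *)

Section InducedSystem.
Context {K : realType}.
Local Notation line := (measurableTypeR K).
Local Notation plane := (line * line)%type.
Local Notation leb := (@lebesgue_measure K).
Local Notation F := (@Farey_ext K).
Implicit Types (z w : plane) (B : set plane).

(** Cut the set by the value of the time: each piece is moved by a fixed iterate, and injectivity
    keeps the images disjoint. *)
Lemma mubar_iter_time_image (r : plane -> nat) B : measurable B ->
  B `<=` good -> (forall n, measurable (r @^-1` [set n])) ->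
  (forall z w, B z -> B w -> iter (r z) F z = iter (r w) F w -> z = w) ->
  mubar ((fun z => iter (r z) F z) @` B) = mubar B.
Proof.
move=> mB BG mr injr; rewrite iter_time_image.
have mBr n : measurable (B `&` r @^-1` [set n]) by exact: measurableI.
have BrG n : B `&` r @^-1` [set n] `<=` good by move=> z [/BG].
have -> : mubar B = mubar (\bigcup_n (B `&` r @^-1` [set n])).
  by congr mubar; apply/seteqP; split => [z Bz|z [n _ []]//]; exists (r z).
have -> : mubar (\bigcup_n (B `&` r @^-1` [set n])) =
    (\sum_(n <oo | n \in setT) mubar (B `&` r @^-1` [set n]))%E.
  apply: measure_bigcup => //.
  by move=> i j _ _ [z [[_ <-] [_ <-]]].
have -> : mubar (\bigcup_n (iter n F @` (B `&` r @^-1` [set n]))) =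
    (\sum_(n <oo | n \in setT) mubar (iter n F @` (B `&` r @^-1` [set n])))%E.
  apply: measure_bigcup => //.
    move=> n _; apply: (stable_images_iter n Farey_ext_stable_images (mBr n) _).1.
    by move=> z /BrG [].
  move=> i j _ _ [_ [[z [Bz <-] <-] [w [Bw <-] wz]]].
  by rewrite (injr _ _ Bw Bz wz).
by apply: eq_eseriesr => n _; exact: mubar_iter_image.
Qed.

Variable alpha : K.
Hypotheses (alpha_gt0 : 0 < alpha) (alpha_le1 : alpha <= 1).
Local Notation R := (domR alpha).
Local Notation S := (Farey_R alpha).

(** The domain stays away from the singularity at the origin: either y > 1/2 and D >= 1/2, or x >=
    alpha and D >= alpha. The bound 4 + alpha^-2 covers both cases. *)
Lemma mubar_domR_lty : (mubar R < +oo)%E.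
Proof.
rewrite -mubar_good; last exact: measurable_domR.
apply: le_lt_trans (ltry (4 + alpha ^- 2)); apply: mubar_le.
- by rewrite addr_ge0// invr_ge0 sqr_ge0.
- by apply: measurableI; [exact: measurable_domR|exact: measurable_good].
move=> z [Rz gz] _; have /goodP[/andP[x0 x1] /andP[y0 y1] _ _] := gz.
rewrite /mubar_density div1r.
have D0 : 0 < denom z.1 z.2 by apply: denom_gt0 => //; exact: ltW.
rewrite -/(denom z.1 z.2).
have a2 : 0 < alpha ^- 2 by rewrite invr_gt0 exprn_gt0.
have [[[_ +] _]|[w [l [gw _ aw /andP[_ ld] zw]]]] := (domRP alpha gz).1 Rz.
  rewrite /= in_itv/= => /andP[yh _].
  apply: (@le_trans _ _ 4); last by rewrite lerDl ltW.
  rewrite -[leRHS]invrK lef_pV2 ?posrE ?invr_gt0 ?exprn_gt0//.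
  have Dh : 2^-1 <= denom z.1 z.2 by rewrite /denom; nra.
  rewrite (_ : 4^-1 = 2^-1 ^+ 2); last by rewrite expr2; field.
  by apply: lerXn2r; rewrite ?nnegrE//; exact: ltW.
apply: (@le_trans _ _ (alpha ^- 2)); last by rewrite lerDr.
rewrite lef_pV2 ?posrE ?exprn_gt0//.
apply: lerXn2r; rewrite ?nnegrE; [exact: ltW|exact: ltW|].
have za : alpha <= z.1.
  by rewrite zw (le_trans aw)// le_iter_Farey_fst//; exact: gw.1.
by rewrite /denom; nra.
Qed.

(** Points of [H1] with x < alpha are sent into [A] by [F_H1], because k is then 1; a box of such
    points has positive measure, which [F_H1] preserves. *)
Lemma mubar_domR_gt0 : (0 < mubar R)%E.
Proof.
pose box : set plane := `]0, alpha[ `*` `]2^-1, 1].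
have mbox : measurable box by exact: measurableX.
have boxO : box `<=` Omega.
  move=> z [/=]; rewrite !in_itv/= => /andP[x0 x1] /andP[y0 y1].
  by apply/OmegaP; split; [lra|exact: le_trans (ltW x1) alpha_le1|lra|lra].
have mG := @measurable_good K.
have mbG : measurable (box `&` good) by exact: measurableI.
have boxH z : (box `&` good) z -> H1 z /\ z.1 < alpha.
  move=> [[/=]]; rewrite !in_itv/= => /andP[x0 x1] /andP[y0 y1] gz.
  split => //; split; rewrite /= in_itv/= ?y0 ?y1//.
  by rewrite (ltW x0) (le_trans (ltW x1)).
have : (0 < (leb \x leb)%E box)%E.
  rewrite product_measure1E//.
  rewrite [X in (X * _)%E](_ : _ = alpha%:E); last first.
    apply: etrans (lebesgue_measure_itv _) _.
    by rewrite /= lte_fin alpha_gt0 oppr0 adde0.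
  rewrite [X in (_ * X)%E](_ : _ = (1 - 2^-1)%:E); last first.
    apply: etrans (lebesgue_measure_itv _) _.
    by rewrite /= lte_fin invf_lt1// ltr1n.
  by rewrite -EFinM lte_fin mulr_gt0//; lra.
move/lt_le_trans; apply.
rewrite (le_trans (mubar_ge mbox boxO _))//.
  by move=> z [/=]; rewrite in_itv/= => /andP[].
rewrite -mubar_good//.
rewrite -(@mubar_iter_time_image (fun z => digit z.1))//.
- apply: le_measure; rewrite ?inE.
  + apply: (F_H1_stable_images mbG _).1.
    by move=> z [/boxO].
  + exact: measurable_domR.
  + move=> _ [z bz <-]; left; have [Hz za] := boxH _ bz.
    by apply: setA_F_H1_lt => //; exact: bz.2.
- exact: measurable_digit_fst.
- move=> z w bz bw; have [Hz _] := boxH _ bz; have [Hw _] := boxH _ bw.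
  by apply: F_H1_inj => //; [exact: bz.2|exact: bw.2].
Qed.

Lemma mubar_domR_fin_num : mubar R \is a fin_num.
Proof. by rewrite ge0_fin_numE// mubar_domR_lty. Qed.

(** The value 0 marks points that never return; the zeroth iterate is the identity, which is the
    default of [induced_map]. *)
Definition return_time z : nat := odflt 0%N (first_return F R z).

Lemma Farey_RE z : S z = iter (return_time z) F z.
Proof. by rewrite /Farey_R /induced_map /return_time; case: first_return. Qed.

Lemma measurable_return_time n : measurable (return_time @^-1` [set n]).
Proof.
have mpos m : measurable (return_time @^-1` [set m.+1]).
  have -> : return_time @^-1` [set m.+1] = iter m.+1 F @^-1` R `\`
      \bigcup_(i in [set i | (0 < i < m.+1)%N]) iter i F @^-1` R.
    apply/seteqP; split => z /=; rewrite /return_time.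
      case E : first_return => [i|]//= im; rewrite im in E.
      move/first_returnP : E => [_ Rz Pz]; split => //.
      by move=> [j jm Rj]; exact: Pz jm Rj.
    move=> [Rz Pz]; suff -> : first_return F R z = Some m.+1 by [].
    by apply/first_returnP; split => // i im Ri; apply: Pz; exists i.
  have mi i : measurable (iter i F @^-1` R).
    rewrite -[X in measurable X]setTI; apply: measurable_iter => //.
      exact: measurable_Farey_ext.
    exact: measurable_domR.
  by apply: measurableD => //; exact: bigcup_measurable.
case: n => [|n]; last exact: mpos.
rewrite (_ : _ @^-1` _ = ~` \bigcup_m return_time @^-1` [set m.+1]).
  by apply: measurableC; exact: bigcup_measurable.
apply/seteqP; split => z /=; first by move=> r0 [m _ /=]; rewrite r0.
by move=> nz; case E : (return_time z) => [|m]//; case: nz; exists m.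
Qed.

Lemma measurable_Farey_R : measurable_fun setT S.
Proof.
rewrite (_ : S = fun z => iter (return_time z) F z).
  exact: measurable_iter_time measurable_Farey_ext measurable_return_time.
by apply/funext => z; exact: Farey_RE.
Qed.

Lemma Farey_R_stable_images : stable_images Omega S.
Proof.
rewrite (_ : S = fun z => iter (return_time z) F z).
  exact: stable_images_iter_time Farey_ext_stable_images measurable_return_time.
by apply/funext => z; exact: Farey_RE.
Qed.

Lemma Farey_R_domR z : R z -> R (S z).
Proof.
rewrite /Farey_R /induced_map; case E : first_return => [n|]//.
by move/first_returnP : E => [].
Qed.

Local Notation Rg := (R `&` good).

Lemma measurable_Rg : measurable Rg.
Proof. by apply: measurableI; [exact: measurable_domR|exact: measurable_good]. Qed.

Lemma Farey_R_ret z : Rg z -> S z = iter (ret alpha z.1) F z.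
Proof.
by move=> [Rz gz]; rewrite /Farey_R /induced_map first_return_ret.
Qed.

Lemma Farey_R_Rg z : Rg z -> Rg (S z).
Proof.
move=> Rgz; split; first exact: Farey_R_domR Rgz.1.
by rewrite Farey_RE; exact: good_iter Rgz.2.
Qed.

(** If the return times differed, cancelling iterates would show that one point is reached from the
    other strictly before the latter's first return. *)
Lemma Farey_R_inj z w : Rg z -> Rg w -> S z = S w -> z = w.
Proof.
have le_case z' w' : Rg z' -> Rg w' -> (ret alpha z'.1 <= ret alpha w'.1)%N ->
    S z' = S w' -> z' = w'.
  move=> Rz Rw zw; rewrite !Farey_R_ret// -(subnKC zw) iterD.
  move/(iter_inj Rz.2 (good_iter _ Rw.2)) => e.
  have /first_returnP[_ _ Pw] := first_return_ret Rw.2 Rw.1.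
  have /first_returnP[rz _ _] := first_return_ret Rz.2 Rz.1.
  case: (posnP (ret alpha w'.1 - ret alpha z'.1)) => [d0|d0].
    by rewrite e d0.
  case: (Pw (ret alpha w'.1 - ret alpha z'.1)%N).
    by rewrite d0/= ltn_subrL rz (leq_trans rz zw).
  by rewrite -e; exact: Rz.1.
move=> Rz Rw e.
case: (leqP (ret alpha z.1) (ret alpha w.1)) => [|/ltnW] h; first exact: le_case.
by apply/esym/le_case.
Qed.

Lemma mubar_Farey_R_image B : measurable B -> B `<=` Rg ->
  mubar (S @` B) = mubar B.
Proof.
move=> mB BR; rewrite -(mubar_iter_time_image mB _ measurable_return_time).
- by congr mubar; apply: eq_imagel => z _; exact: Farey_RE.
- by move=> z /BR[].
- by move=> z w /BR Rz /BR Rw; rewrite -!Farey_RE; exact: Farey_R_inj.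
Qed.

(** The points with arbitrarily long [S]-pasts among good points of the domain. *)
Definition core : set plane := \bigcap_n (iter n S @` Rg).

Lemma measurable_iter_Rg n : measurable (iter n S @` Rg).
Proof.
apply: (stable_images_iter n Farey_R_stable_images measurable_Rg _).1.
by move=> z [_ []].
Qed.

Lemma iter_Rg n z : Rg z -> Rg (iter n S z).
Proof. by move=> Rz; elim: n => //= n; exact: Farey_R_Rg. Qed.

Lemma measurable_core : measurable core.
Proof. by apply: bigcapT_measurable => n; exact: measurable_iter_Rg. Qed.

Lemma core_Rg : core `<=` Rg.
Proof. by move=> z /(_ 0%N I)[w Rw <-]. Qed.

(* [S] is injective and measure preserving on a set of finite measure, hence
   onto up to a null set. In particular the points whose [past_hit] is infinite
   need no separate recurrence argument. *)
Lemma mubar_core : mubar core = mubar R.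
Proof.
have mR n : mubar (iter n S @` Rg) = mubar R.
  elim: n => [|n IH].
    by rewrite image_id mubar_good//; exact: measurable_domR.
  rewrite (_ : iter n.+1 S @` Rg = S @` (iter n S @` Rg)); last by rewrite -image_comp.
  rewrite mubar_Farey_R_image//; first exact: measurable_iter_Rg.
  by move=> _ [z Rz <-]; exact: iter_Rg.
have : mubar (iter n S @` Rg) @[n --> \oo] --> mubar core.
  apply: nonincreasing_cvg_mu.
  - by have := mubar_domR_lty; rewrite -(mR 0%N).
  - exact: measurable_iter_Rg.
  - exact: measurable_core.
  - move=> m n mn; apply/subsetPset => _ [z Rz <-].
    rewrite -(subnKC mn) iterD; exists (iter (n - m) S z) => //.
    exact: iter_Rg.
rewrite (_ : (fun n => mubar (iter n S @` Rg)) = cst (mubar R)); last exact/funext.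
by move=> h; apply: (cvg_unique _ h) => //; exact: cvg_cst.
Qed.

Lemma Farey_R_core z : core z -> core (S z).
Proof.
move=> Cz n _; case: n => [|n].
  by exists (S z) => //; apply: Farey_R_Rg; exact: core_Rg.
by have [w Rw <-] := Cz n I; exists w.
Qed.

(** The preimage of [z] among good points of the domain is unique, so every longer past of [z]
    passes through it and it has arbitrarily long pasts too. *)
Lemma Farey_R_core_surj z : core z -> exists2 w, core w & S w = z.
Proof.
move=> Cz; have [w Rw wz] := Cz 1%N I; exists w => // n _.
have [v Rv vz] := Cz n.+1 I.
have <- : iter n S v = w.
  by apply: Farey_R_inj => //; [exact: iter_Rg|rewrite -iterS vz].
by exists v.
Qed.

Lemma iter_core_surj n z : core z -> exists2 w, core w & iter n S w = z.
Proof.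
elim: n z => [|n IH] z Cz; first by exists z.
have [w Cw <-] := Farey_R_core_surj Cz.
by have [v Cv <-] := IH _ Cw; exists v.
Qed.

Lemma iter_core n z : core z -> core (iter n S z).
Proof. by move=> Cz; elim: n => //= n; exact: Farey_R_core. Qed.

Lemma mubarI_core B : measurable B -> mubar (B `&` R) = mubar (B `&` core).
Proof.
move=> mB; have mC := measurable_core; have mR := measurable_domR alpha.
have RCE : R = core `|` (R `\` core).
  by rewrite setDUK// => z /core_Rg[].
have RC0 : mubar (R `\` core) = 0%E.
  have : mubar R = (mubar core + mubar (R `\` core))%E.
    rewrite {1}RCE mubarU//; first exact: measurableD.
    by rewrite setDIK.
  rewrite mubar_core addeC => e.
  have fR := mubar_domR_fin_num.
  by rewrite -[LHS](addeK _ fR) -e subee.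
rewrite {1}RCE setIUr mubarU.
- rewrite [X in (_ + X)%E](_ : _ = 0%E) ?adde0//.
  apply: (subset_measure0 (mu := mubar) _ _ _ RC0).
  + by apply: measurableI => //; exact: measurableD.
  + exact: measurableD.
  + by move=> z [].
- exact: measurableI.
- by apply: measurableI => //; exact: measurableD.
- by apply/seteqP; split => // z [[_ h] [_ []]].
Qed.

(** On the core [S] is onto, so it carries the preimage of [B] exactly onto [B], and image
    invariance applies. *)
Lemma mubar_Farey_R_preimage B : measurable B ->
  mubar (R `&` S @^-1` B) = mubar (B `&` R).
Proof.
move=> mB; have mSB : measurable (S @^-1` B).
  by rewrite -[X in measurable X]setTI; exact: measurable_Farey_R.
rewrite setIC !mubarI_core//.
rewrite -mubar_Farey_R_image.
- congr mubar; apply/seteqP; split => [_ [z [Bz Cz] <-]|z [Bz Cz]].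
    by split => //; exact: Farey_R_core.
  by have [w Cw wz] := Farey_R_core_surj Cz; exists w => //; split=> //; rewrite /= wz.
- by apply: measurableI => //; exact: measurable_core.
- by move=> z [_ /core_Rg].
Qed.

End InducedSystem.

(** * The factor map and the generated sigma-algebra *)

Section Factor.
Context {K : realType}.
Local Notation line := (measurableTypeR K).
Local Notation plane := (line * line)%type.
Local Notation leb := (@lebesgue_measure K).
Local Notation F := (@Farey_ext K).
Implicit Types (z w u v : plane) (x t : line) (B : set plane).

Variable alpha : K.
Hypotheses (alpha_gt0 : 0 < alpha) (alpha_le1 : alpha <= 1).
Local Notation R := (domR alpha).
Local Notation S := (Farey_R alpha).
Local Notation Rg := (R `&` good).
Local Notation Y0 := (@core K alpha).

(* On [domR alpha] the value [x - 1] represents [x >= alpha], the point of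
   [alpha - 1, alpha[ congruent to [x] modulo 1. *)
Definition factor z : line := if z.1 < alpha then z.1 else z.1 - 1.

Definition unfactor t : line := if t < 0 then t + 1 else t.

Lemma factorK z : good z -> unfactor (factor z) = z.1.
Proof.
move=> /goodP[/andP[x0 x1] _ _ _]; rewrite /factor.
have [xa|xa] := ltP z.1 alpha; rewrite /unfactor; first by rewrite ltNge (ltW x0).
by rewrite subr_lt0 x1 subrK.
Qed.

Lemma measurable_factor : measurable_fun setT factor.
Proof.
apply: measurable_fun_ifT => //.
- by apply: measurable_fun_ltr => //; exact: measurable_fst.
- by apply: measurable_funB.
Qed.

Lemma measurable_unfactor : measurable_fun setT unfactor.
Proof.
apply: measurable_fun_ifT => //.
- by apply: measurable_fun_ltr.
- by apply: measurable_funD.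
Qed.

Lemma factor_I z : good z -> I_ alpha (factor z).
Proof.
move=> /goodP[/andP[x0 x1] _ _ _]; rewrite /I_ /factor /= in_itv/=.
have [xa|xa] := ltP z.1 alpha.
  by rewrite xa andbT; apply: le_trans (ltW x0); rewrite subr_le0.
by rewrite lerD2r xa/=; apply: lt_trans alpha_gt0; rewrite subr_lt0.
Qed.

(** The floor in Nakada's map chooses the representative modulo 1 in [alpha - 1, alpha), which is
    also how [factor] treats a first coordinate. *)
Lemma sub_floor (m : nat) (s : K) : 0 < s -> s < 1 ->
  m%:R + s - (Num.floor (m%:R + s + 1 - alpha))%:~R =
  if s < alpha then s else s - 1.
Proof.
move=> s0 s1; have a0 := alpha_gt0; have a1 := alpha_le1.
have [sa|sa] := ltP s alpha.
  rewrite (@floor_def _ _ m%:Z); first by rewrite -pmulrn addrAC subrr add0r.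
  by rewrite intrD !mulr1z -!pmulrn; apply/andP; split; lra.
rewrite (@floor_def _ _ (m%:Z + 1)).
  by rewrite intrD !mulr1z -!pmulrn; lra.
by rewrite !intrD !mulr1z -!pmulrn; apply/andP; split; lra.
Qed.

Lemma Nakada_factor z : Rg z -> factor (S z) = Nakada alpha (factor z).
Proof.
move=> Rz; have [RRz gz] := Rz; have /goodP[/andP[x0 x1] _ _ _] := gz.
have [_ gS] := Farey_R_Rg Rz; have /goodP[/andP[s0 s1] _ _ _] := gS.
(* It suffices that 1/|factor z| and the first coordinate of [S z] differ by a natural number. The
   three branches of [ret] give m = a(x), m = 1 and m = a(u) + 1 with u = (1 - x)/x, the last since
   1/(1 - x) = 1 + 1/u. *)
suff [f0 [m mE]] : factor z != 0 /\ exists m : nat, 1 / `|factor z| = m%:R + (S z).1.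
  by rewrite /Nakada (negbTE f0) mE sub_floor.
rewrite Farey_R_ret// /factor /ret.
have [xa|xa] := ltP z.1 alpha.
  split; first by rewrite gt_eqF.
  exists (digit z.1); rewrite gtr0_norm// -/(F_H1 z) F_H1_fst//; lra.
split; first by rewrite lt_eqF// subr_lt0.
rewrite ltr0_norm ?subr_lt0// opprB.
have [xh|xh] := leP z.1 2^-1.
  exists 1%N; rewrite /= /Farey_ext xh /=; field; lra.
set u := (1 - z.1) / z.1.
have uE : (F z).1 = u by rewrite /Farey_ext (lt_geF xh).
have gF := good_Farey_ext gz.
exists (digit u).+1; rewrite iterSr.
rewrite (_ : iter _ _ _ = F_H1 (F z)); last by rewrite /F_H1 uE.
rewrite F_H1_fst// uE -natr1 /u; field; lra.
Qed.

Lemma measurable_digit : measurable_fun setT (@digit K : line -> nat).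
Proof.
move=> _ Y _; rewrite setTI.
rewrite (_ : _ @^-1` Y = \bigcup_(n in Y) (@digit K) @^-1` [set n]).
  by apply: bigcup_measurable => n _; exact: measurable_digit_preimage.
by apply/seteqP; split => [x Yx|x [n Yn /= ->]//]; exists (digit x).
Qed.

Lemma measurable_ret : measurable_fun setT (ret alpha : line -> nat).
Proof.
apply: measurable_fun_ifT.
- by apply: measurable_fun_ltr.
- exact: measurable_digit.
- apply: measurable_fun_ifT => //.
  + by apply: measurable_fun_ler.
  + apply: (measurableT_comp (f := succn)) => //.
    apply: (measurableT_comp measurable_digit).
    by apply: measurable_fun_divr => //; apply: measurable_funB.
Qed.

Definition ret_map z : plane := iter (ret alpha z.1) F z.

Lemma measurable_ret_map : measurable_fun setT ret_map.
Proof.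
apply: measurable_iter_time; first exact: measurable_Farey_ext.
move=> n; rewrite -[X in measurable X]setTI.
exact: (measurableT_comp measurable_ret measurable_fst).
Qed.

Definition close (n : nat) u v :=
  [/\ u.1 = v.1, 0 <= u.2 <= 1, 0 <= v.2 <= 1 & `|u.2 - v.2| * n.+1%:R <= 1].

(* On second coordinates both branches send a distance [d] to
   [d / ((1 + y) * (1 + y')) <= d / (1 + d)]. *)
Lemma close_Farey n u v : close n u v -> close n.+1 (F u) (F v).
Proof.
case: u v => [x y] [x' y'] [/= <- /andP[y0 y1] /andP[y0' y1'] yn].
have yp : 0 < 1 + y by lra.
have yp' : 0 < 1 + y' by lra.
have P0 : 0 < (1 + y) * (1 + y') by rewrite mulr_gt0.
have key : `|y - y'| / ((1 + y) * (1 + y')) * n.+2%:R <= 1.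
  rewrite mulrAC ler_pdivrMr// mul1r -natr1 mulrDr mulr1.
  have : `|y - y'| <= y + y' by rewrite ler_norml; apply/andP; split; lra.
  by nra.
rewrite /Farey_ext/=; case: ifPn => _; split => //=.
- by rewrite divr_ge0 ?addr_ge0//= ler_pdivrMr//; lra.
- by rewrite divr_ge0 ?addr_ge0//= ler_pdivrMr//; lra.
- rewrite (_ : _ - _ = (y - y') / ((1 + y) * (1 + y'))).
    by rewrite normrM normfV (gtr0_norm P0).
  by field; rewrite !gt_eqF.
- by rewrite divr_ge0 ?addr_ge0//= ler_pdivrMr//; lra.
- by rewrite divr_ge0 ?addr_ge0//= ler_pdivrMr//; lra.
- rewrite (_ : _ - _ = - ((y - y') / ((1 + y) * (1 + y')))).
    by rewrite normrN normrM normfV (gtr0_norm P0).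
  by field; rewrite !gt_eqF.
Qed.

Lemma close_le n m u v : (n <= m)%N -> close m u v -> close n u v.
Proof.
move=> nm [e u01 v01 uv]; split => //; apply: le_trans uv.
by rewrite ler_wpM2l// ler_nat.
Qed.

Lemma close_iter n m u v : close n u v -> close (m + n) (iter m F u) (iter m F v).
Proof. by move=> uv; elim: m => //= m; exact: close_Farey. Qed.

Lemma ret_gt0 z : good z -> (0 < ret alpha z.1)%N.
Proof.
move=> gz; rewrite /ret; case: ifPn => _; first exact: digit_good_gt0.
by case: ifPn.
Qed.

Lemma close_ret_map n u v : good u -> close n u v ->
  close n.+1 (ret_map u) (ret_map v).
Proof.
move=> gu uv; have [e _ _ _] := uv; rewrite /ret_map -e.
apply: close_le (close_iter (ret alpha u.1) uv).
by rewrite -add1n leq_add2r ret_gt0.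
Qed.

(* The second coordinate of [iter n S w], computed from [factor w] alone with
   the unknown second coordinate of [w] replaced by [0]. *)
Definition approx (n : nat) t : line := (iter n ret_map (unfactor t, 0)).2.

Lemma measurable_approx n : measurable_fun setT (approx n).
Proof.
have mi := measurable_iter n measurable_ret_map.
apply: (measurableT_comp measurable_snd); apply: (measurableT_comp mi).
by apply: measurable_fun_pair => //; exact: measurable_unfactor.
Qed.

Lemma approx_close n w : Rg w ->
  `|(iter n S w).2 - approx n (factor w)| * n.+1%:R <= 1.
Proof.
move=> Rw; rewrite /approx factorK; last exact: Rw.2.
suff [_ _ _] : close n (iter n S w) (iter n ret_map (w.1, 0)) by [].
elim: n => [|n IH] /=.
  have /goodP[_ /andP[y0 y1] _ _] := Rw.2.
  by split; rewrite //= ?lexx ?ler01 ?(ltW y0) ?(ltW y1)// subr0 mulr1 ger0_norm ?ltW.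
have Rn := iter_Rg n Rw.
by rewrite Farey_R_ret//; apply: close_ret_map => //; exact: Rn.2.
Qed.

Definition generator : set (set plane) :=
  [set E | exists (n : nat) (B : set line), measurable B /\
     E = iter n S @` (Y0 `&` factor @^-1` B)].

(** Half-planes in x are preimages under the factor. Half-planes in y are countable unions of
    generators, since y at time n is known up to 1/(n + 1) from the factor at time 0. *)
Lemma generated C : measurable C -> <<s Y0, generator >> (Y0 `&` C).
Proof.
apply: measurable_plane_ind; first exact: smallest_sigma_algebra.
- move=> a; apply: sub_sigma_algebra.
  exists 0%N, (unfactor @^-1` `]a, +oo[%classic); split.
    by rewrite -[X in measurable X]setTI; exact: measurable_unfactor.
  rewrite image_id; apply/seteqP; split => z [Yz] /=; rewrite ?in_itv/= andbT;
    by rewrite factorK//; exact: (core_Rg Yz).2.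
- move=> c.
  (* The margin 1/(n + 1) absorbs the approximation error, so images of these sets do lie above
     c. *)
  pose B n := approx n @^-1` `]c + n.+1%:R^-1, +oo[%classic.
  have -> : Y0 `&` [set z | c < z.2] = \bigcup_n (iter n S @` (Y0 `&` factor @^-1` B n)).
    apply/seteqP; split => [z [Yz /= cz]|_ [n _ [w [Yw +] <-]]].
      (* Chosen so that 2/(n + 1) < y - c: one 1/(n + 1) for the error, one for the margin. *)
      pose n := Num.truncn (2 / (z.2 - c)).
      have [w Yw wz] := iter_core_surj n Yz.
      exists n => //; exists w => //; split => //.
      rewrite /B /= in_itv/= andbT.
      have := approx_close n (core_Rg Yw); rewrite wz.
      have n0 : 0 < n.+1%:R :> K by rewrite ltr0n.
      have := truncnS_gt (2 / (z.2 - c)); rewrite -/n.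
      rewrite ltr_pdivrMr ?subr_gt0// -ler_pdivlMr// div1r => h1.
      rewrite ler_norml => /andP[_ h2].
      have h3 : 2 * n.+1%:R^-1 < z.2 - c by rewrite ltr_pdivrMr// mulrC.
      by move: h2 h3; set q := _^-1; set y := approx _ _ => h2 h3; lra.
    rewrite /B /= in_itv/= andbT => h.
    split; first exact: iter_core.
    have n0 : 0 < n.+1%:R :> K by rewrite ltr0n.
    have := approx_close n (core_Rg Yw).
    rewrite -ler_pdivlMr// div1r ler_norml => /andP[h1 _] /=.
    by move: h h1; set q := _^-1; lra.
  have [_ _] := @smallest_sigma_algebra _ Y0 generator; apply => n.
  apply: sub_sigma_algebra; exists n, (B n); split => //.
  by rewrite -[X in measurable X]setTI; exact: measurable_approx.
Qed.

(** * The normalized measure and its image under the factor map *)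

Variable mR : measurable R.
Local Notation nu := (mubar_restr mR).

(** Positivity and finiteness of the total mass rule out the Dirac default of [mnormalize]. *)
Lemma mubar_restrE B : nu B = (mubar (B `&` R) * (fine (mubar R))^-1%:E)%E.
Proof.
rewrite /mubar_restr /= /mnormalize /=.
have -> : mrestr mubar mR setT = mubar R by rewrite /mrestr setTI.
by rewrite ifF// gt_eqF ?mubar_domR_gt0//= lt_eqF// mubar_domR_lty.
Qed.

Lemma mubar_restr_core B : measurable B -> nu (B `&` Y0) = nu B.
Proof.
move=> mB; have mY := measurable_core alpha; rewrite !mubar_restrE.
have mBY : measurable (B `&` Y0) by exact: measurableI.
by rewrite !mubarI_core// -setIA setIid.
Qed.

Lemma mubar_restr_domR : nu R = 1%E.
Proof.
rewrite mubar_restrE setIid -[X in (X * _)%E]fineK ?mubar_domR_fin_num//.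
rewrite -EFinM mulfV// fine_eq0 ?mubar_domR_fin_num//.
by rewrite gt_eqF// mubar_domR_gt0.
Qed.

Lemma mp_system_Farey_R : mp_system R nu S.
Proof.
split.
- by split; [|exact: mubar_restr_domR].
- by move=> z; exact: Farey_R_domR.
- exact: measurable_funTS (measurable_Farey_R alpha).
- move=> B mB; rewrite !mubar_restrE -[in RHS]mubar_Farey_R_preimage//.
  by rewrite setIAC setIid.
Qed.

Lemma lebesgue_measure_shift (r : K) (N : set line) : measurable N ->
  leb ((fun x => x - r) @^-1` N) = leb N.
Proof.
move=> mN; have mshift : measurable_fun setT (fun x : line => x - r : line).
  by apply: measurable_funB.
apply/esym; apply: (@lebesgue_measure_unique _
  (pushforward leb (fun x : line => x - r : line))) => //= _ [[a b]] _ <-.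
rewrite /pushforward (_ : _ @^-1` _ = `]a + r, b + r]%classic).
  by rewrite !lebesgue_measure_itv/= !lte_fin ltrD2r -!EFinB opprD addrACA subrr addr0.
by apply/seteqP; split => x /=; rewrite !in_itv/= ltrBrDr lerBlDr.
Qed.

(** The preimage is contained in two vertical strips, over [N] and over its translate by 1. *)
Lemma mubar_factor_null (N : set line) : measurable N -> leb N = 0%E ->
  mubar (factor @^-1` N) = 0%E.
Proof.
move=> mN N0; pose N' : set line := (fun x => x - 1) @^-1` N.
have mN' : measurable N'.
  rewrite -[X in measurable X]setTI.
  by apply: (measurable_funB (f := id) (g := cst 1)).
have N'0 : leb N' = 0%E by rewrite lebesgue_measure_shift.
have [NT _] := mubarXT_null mN N0; have [N'T _] := mubarXT_null mN' N'0.
apply: (subset_measure0 (mu := mubar) (B := N `*` setT `|` N' `*` setT)).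
- by rewrite -[X in measurable X]setTI; exact: measurable_factor.
- by apply: measurableU; exact: measurableX.
- by move=> z; rewrite /= /factor; case: ifPn => _ Nz; [left|right].
apply/eqP; rewrite eq_le measure_ge0 andbT.
have h : (mubar (N `*` setT `|` N' `*` setT : set plane) <=
    mubar (N `*` setT : set plane) + mubar (N' `*` setT : set plane))%E.
  by apply: measureU2; exact: measurableX.
by rewrite (le_trans h)// NT N'T adde0.
Qed.

(** By uniqueness of the invariant probability it is enough that the pushforward is invariant and
    absolutely continuous. *)
Lemma factor_distribution (rho : probability line K) : unique_acip alpha rho ->
  forall B : set line, measurable B -> nu (factor @^-1` B) = rho B.
Proof.
move=> [[[_ Gst mG _] _] rho_uniq].
have pf : factor \in (mfun : {pred plane -> line}).
  by rewrite inE; exact: measurable_factor.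
have mf (X : set line) : measurable X -> measurable (factor @^-1` X).
  by move=> mX; rewrite -[X in measurable X]setTI; exact: measurable_factor.
have mI : measurable (I_ alpha) by exact: measurable_itv.
have [_ _ _ nuS] := mp_system_Farey_R.
apply: (rho_uniq (distribution nu (mfun_Sub pf))); split; last first.
  apply/null_content_dominatesP => X mX X0.
  rewrite /distribution /pushforward /= mubar_restrE.
  rewrite (_ : mubar _ = 0%E) ?mul0e//.
  apply: (subset_measure0 (mu := mubar) _ _ _ (mubar_factor_null mX X0)).
  - by apply: measurableI; [exact: mf|].
  - exact: mf.
  - by move=> z [].
split => //.
- split => //; transitivity (nu setT); last exact: probability_setT.
  rewrite /distribution /pushforward /=.
  rewrite -[LHS]mubar_restr_core; last exact: mf.
  rewrite -[RHS]mubar_restr_core//; congr (nu _).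
  apply/seteqP; split => z [] // _ Yz; split => //=.
  exact: factor_I (core_Rg Yz).2.
- move=> X mX; rewrite /distribution /pushforward /=.
  rewrite -[RHS]nuS; last exact: mf.
  have mGX : measurable (I_ alpha `&` Nakada alpha @^-1` X) by exact: mG.
  (* Both events are compared on the core, which has full measure and where the intertwining
     relation holds pointwise. *)
  rewrite -[LHS]mubar_restr_core; last exact: mf.
  rewrite -[RHS]mubar_restr_core; last first.
    by apply: measurable_funTS => //; [exact: measurable_Farey_R|exact: mf].
  congr (nu _); apply/seteqP; split => z [] /=.
    move=> [_ Gz] Yz; split => //; split; first exact: (core_Rg Yz).1.
    by rewrite Nakada_factor//; exact: core_Rg.
  move=> [Rz fz] Yz; split => //; split; first exact: factor_I (core_Rg Yz).2.
  by rewrite -Nakada_factor//; exact: core_Rg.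
Qed.

Lemma invertible_core_Farey_R : invertible_core R nu S Y0.
Proof.
have mY := measurable_core alpha; split.
- split => //; rewrite -(setTI Y0) mubar_restr_core//.
  exact: probability_setT.
- by move=> z /core_Rg[].
- split; first by move=> z; exact: Farey_R_core.
    move=> z w /set_mem/core_Rg Rz /set_mem/core_Rg Rw.
    exact: Farey_R_inj.
  by move=> z Yz; have [w Yw wz] := Farey_R_core_surj Yz; exists w.
- exact: measurable_funTS (measurable_Farey_R alpha).
- move=> B mB BY; apply: (@Farey_R_stable_images K alpha B mB _).1.
  by move=> z /BY/core_Rg[_ []].
Qed.

End Factor.

Unset Implicit Arguments.
Set Strict Implicit.
Set Printing Implicit Defensive.

Theorem theorem7p11 (K : realType) (alpha : K) (alpha_gt0 : 0 < alpha)
    (alpha_le1 : alpha <= 1) (rho : probability (measurableTypeR K) K)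
    (rhoP : unique_acip alpha rho) :
  exists mR : measurable (domR alpha),
    (0 < mubar (domR alpha) < +oo)%E /\
    natural_extension (domR alpha) (mubar_restr mR) (Farey_R alpha)
      (I_ alpha) rho (Nakada alpha).
Proof.
have mR := measurable_domR alpha; have mY := measurable_core alpha.
exists mR; split; first by rewrite mubar_domR_gt0// mubar_domR_lty.
split.
- by case: rhoP => -[].
- exact: mp_system_Farey_R.
exists (core alpha), (factor alpha); split.
- exact: invertible_core_Farey_R.
- split; last exact: measurable_funTS (measurable_factor alpha).
  by move=> z /core_Rg[_ gz]; exact: factor_I.
- by move=> z /core_Rg; exact: Nakada_factor.
- move=> B mB; rewrite -(factor_distribution alpha_gt0 alpha_le1 mR rhoP mB).
  rewrite setIC mubar_restr_core//.
  by rewrite -[X in measurable X]setTI; exact: measurable_factor.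
(* The trace of [C] on the core is generated exactly; the symmetric difference is the part of [C]
   off the core, a null set. *)
- move=> C mC; exists (core alpha `&` C); first exact: generated.
  have -> : C `+` (core alpha `&` C) = C `\` core alpha.
    apply/seteqP; split => [z [[Cz nz]|[[_ Cz] nz]]//|z [Cz nz]].
      by split => // Yz; apply: nz.
    by left; split => // -[].
  rewrite -mubar_restr_core//; last exact: measurableD.
  by rewrite setDKI measure0.
Qed.
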